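(* The real Argyros--Motakis space $\mathfrak{X}_{\mathrm{ISP}}$ (described in the context) is Lotz-saturated. It is itself non-Lotz.
   Context: For a real Banach space $Y$, $\mathcal{L}(Y)$, $\mathcal{K}(Y)$, $\mathcal{SS}(Y)$ denote the bounded, compact, and strictly singular operators on $Y$ ($S$ is strictly singular if no restriction of $S$ to an infinite-dimensional closed subspace is an isomorphism onto its range). A $C_0$-semigroup on $Y$ is a family $(T(t))_{t\ge 0}\subset\mathcal{L}(Y)$ with $T(0)=I_Y$, $T(t+s)=T(t)T(s)$, and $\lim_{t\downarrow 0}\|T(t)x-x\|=0$ for all $x\in Y$; it is uniformly continuous if $\lim_{t\downarrow 0}\|T(t)-I_Y\|=0$. $Y$ has the Lotz property if every $C_0$-semigroup on $Y$ is uniformly continuous, and is non-Lotz otherwise. A Banach space $E$ is Lotz-saturated if every infinite-dimensional closed subspace of $E$ contains an infinite-dimensional closed subspace with the Lotz property. A bounded sequence $(x_n)$ generates a basic sequence $(e_n)$ as a spreading model if for every $k\in\mathbb{N}$, $\lim_{n_1\to\infty,\ n_1<\cdots<n_k}\|\sum_{j=1}^k a_jx_{n_j}\|=\|\sum_{j=1}^k a_je_j\|$, uniformly for $(a_1,\dots,a_k)\in[-1,1]^k$. $\mathfrak{X}_{\mathrm{ISP}}$ is a fixed infinite-dimensional separable reflexive real Banach space with a Schauder basis with the following known properties (taken as given): it is hereditarily indecomposable (no infinite-dimensional closed subspace is a topological direct sum of two infinite-dimensional closed subspaces), and every infinite-dimensional closed subspace $Y\subset\mathfrak{X}_{\mathrm{ISP}}$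 satisfies: $Y$ admits a normalized weakly null sequence generating the unit vector basis of $\ell_1$ as a spreading model; every $T\in\mathcal{L}(Y)$ has the form $T=\alpha I_Y+S$ with $\alpha\in\mathbb{R}$, $S\in\mathcal{SS}(Y)$; and $QST\in\mathcal{K}(Y)$ for all $Q,S,T\in\mathcal{SS}(Y)$. *)

(* Defs.v *)
From HB Require Import structures.
From mathcomp Require Import all_boot all_order all_algebra.
From mathcomp Require Import boolp classical_sets functions cardinality.
From mathcomp Require Import reals topology normedtype sequences.

Set Implicit Arguments.
Unset Strict Implicit.
Unset Printing Implicit Defensive.

Import Order.TTheory GRing.Theory Num.Theory.
Import numFieldNormedType.Exports.

Local Open Scope classical_set_scope.
Local Open Scope ring_scope.

Section bounded_operators.
Context {R : realType} (E F : normedModType R).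

Definition bounded_linear : {pred E -> F} :=
  fun f => `[< linear f /\ bounded_fun_norm f >].

Lemma bounded_linear_submod_closed : submod_closed bounded_linear.
Proof.
split; first by apply/asboolP; split=> [a x y|r];
  [rewrite scaler0 addr0|exists 0 => x _; rewrite normr0].
move=> a f g /asboolP[lf bf] /asboolP[lg bg]; apply/asboolP; split.
  move=> b x y; rewrite /= !fctE lf lg !scalerDr !scalerA [a * b]mulrC.
  by rewrite addrACA.
move=> r; have [M fM] := bf r; have [N gN] := bg r.
exists (`|a| * M + N) => x xr; rewrite !fctE.
rewrite (le_trans (ler_normD _ _))// normrZ lerD ?gN//.
by rewrite ler_wpM2l ?normr_ge0 ?fM.
Qed.

HB.instance Definition _ :=
  GRing.isSubmodClosed.Build R (E -> F) bounded_linear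
    bounded_linear_submod_closed.

Record bounded_operator := BoundedOperator {
  opfun :> E -> F;
  _ : opfun \in bounded_linear }.

HB.instance Definition _ := [isSub for opfun].
HB.instance Definition _ := [Choice of bounded_operator by <:].
HB.instance Definition _ :=
  [SubChoice_isSubLmodule of bounded_operator by <:].

Implicit Types f g : bounded_operator.

Lemma opP f g : f =1 g -> f = g.
Proof. by move=> fg; apply/val_inj/funext. Qed.

Lemma op_linear f : linear f.
Proof. by case: f => f /= /asboolP[]. Qed.

Lemma op_bounded f : bounded_fun_norm f.
Proof. by case: f => f /= /asboolP[]. Qed.

Lemma op0 f : f 0 = 0.
Proof.
by have := op_linear f (-1) 0 0; rewrite !scaleN1r !addNr.
Qed.

Lemma opZ f a x : f (a *: x) = a *: f x.
Proof. by have := op_linear f a x 0; rewrite !addr0 op0 addr0. Qed.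

Definition opnorm f : R := sup [set `|f x| | x in [set x | `|x| <= 1]].

Lemma opnorm_has_sup f : has_sup [set `|f x| | x in [set x | `|x| <= 1]].
Proof.
split; first by exists `|f 0|, 0 => //=; rewrite normr0.
by have [M fM] := op_bounded f 1; exists M => _ [x x1 <-]; exact: fM.
Qed.

Lemma opnorm_ub f x : `|x| <= 1 -> `|f x| <= opnorm f.
Proof.
by move=> x1; apply: (sup_upper_bound (opnorm_has_sup f)); exists x.
Qed.

Lemma opnorm_le f (M : R) :
  (forall x, `|x| <= 1 -> `|f x| <= M) -> opnorm f <= M.
Proof.
move=> fM; apply: ge_sup; first by case: (opnorm_has_sup f).
by move=> _ [x x1 <-]; exact: fM.
Qed.

Lemma opnorm_ge0 f : 0 <= opnorm f.
Proof. by rewrite (le_trans _ (@opnorm_ub f 0 _)) ?normr0. Qed.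

Lemma le_opnorm f x : `|f x| <= opnorm f * `|x|.
Proof.
have [->|x0] := eqVneq x 0; first by rewrite op0 !normr0 mulr0.
have nx : 0 < `|x| by rewrite normr_gt0.
have := @opnorm_ub f (`|x|^-1 *: x).
rewrite opZ !normrZ !normfV !normr_id mulVf ?gt_eqF// => /(_ (lexx _)).
by rewrite mulrC ler_pdivrMr.
Qed.

Lemma opnormD f g : opnorm (f + g) <= opnorm f + opnorm g.
Proof.
apply: opnorm_le => x x1.
by rewrite (le_trans (ler_normD _ _))// lerD ?opnorm_ub.
Qed.

Lemma opnormZ (a : R) f : opnorm (a *: f) = `|a| * opnorm f.
Proof.
apply/eqP; rewrite eq_le; apply/andP; split.
  by apply: opnorm_le => x x1; rewrite normrZ ler_wpM2l ?opnorm_ub.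
have [->|a0] := eqVneq a 0; first by rewrite normr0 mul0r opnorm_ge0.
rewrite -ler_pdivlMl ?normr_gt0//; apply: opnorm_le => x x1.
rewrite ler_pdivlMl ?normr_gt0// -normrZ.
exact: (@opnorm_ub (a *: f) x).
Qed.

Lemma opnorm0_eq0 f : opnorm f = 0 -> f = 0.
Proof.
move=> f0; apply: opP => x; apply/eqP; rewrite -normr_le0.
by rewrite (le_trans (le_opnorm f x))// f0 mul0r.
Qed.

HB.instance Definition _ :=
  Lmodule_isNormed.Build R bounded_operator opnormD opnormZ opnorm0_eq0.

End bounded_operators.

Arguments bounded_linear {R E F}.

Notation "''L' ( E , F )" := (bounded_operator E F)
  (at level 8, format "''L' ( E ,  F )") : type_scope.

Section identity_composition.
Context {R : realType} {E F G : normedModType R}.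

Lemma id_bounded_linear : (id : E -> E) \in bounded_linear.
Proof. by apply/asboolP; split=> // r; exists r. Qed.

Definition idop : 'L(E, E) := BoundedOperator id_bounded_linear.

Lemma comp_bounded_linear (g : 'L(F, G)) (f : 'L(E, F)) :
  (g \o f) \in bounded_linear.
Proof.
apply/asboolP; split=> [a x y|r]; first by rewrite /= !op_linear.
have [M fM] := op_bounded f r; have [N gN] := op_bounded g M.
by exists N => x /fM/gN.
Qed.

Definition compop (g : 'L(F, G)) (f : 'L(E, F)) : 'L(E, G) :=
  BoundedOperator (comp_bounded_linear g f).

End identity_composition.

Arguments idop {R} E.

Notation "g '\oL' f" := (compop g f)
  (at level 40, left associativity, format "g  \oL  f").

Section closed_subspaces.
Context {R : realType} (E : completeNormedModType R).

Record closed_subspace := ClosedSubspace {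
  csub_set :> set E;
  csub_submod : submod_closed (mem csub_set);
  csub_closed : closed csub_set }.

Variable Y : closed_subspace.

Definition in_csub : {pred E} := mem (csub_set Y).

HB.instance Definition _ :=
  GRing.isSubmodClosed.Build R E in_csub (csub_submod Y).

Record csub := Csub { csub_val :> E; _ : csub_val \in in_csub }.

HB.instance Definition _ := [isSub for csub_val].
HB.instance Definition _ := [Choice of csub by <:].
HB.instance Definition _ := [SubChoice_isSubLmodule of csub by <:].

Definition csub_norm (x : csub) : R := `|csub_val x|.

Lemma csub_normD x y : csub_norm (x + y) <= csub_norm x + csub_norm y.
Proof. exact: ler_normD. Qed.

Lemma csub_normZ (a : R) x : csub_norm (a *: x) = `|a| * csub_norm x.
Proof. exact: normrZ. Qed.

Lemma csub_norm0_eq0 x : csub_norm x = 0 -> x = 0.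
Proof. by move=> /eqP; rewrite normr_eq0 => /eqP x0; exact: val_inj. Qed.

HB.instance Definition _ :=
  Lmodule_isNormed.Build R csub csub_normD csub_normZ csub_norm0_eq0.

Lemma csub_cauchy_cvg (G : set_system csub) :
  ProperFilter G -> cauchy G -> cvg G.
Proof.
move=> PG /cauchy_ballP cG.
have cvG : cauchy (csub_val @ G).
  apply/cauchy_ballP => e e0; have [[A B] /= [GA GB] AB] := cG e e0.
  exists (csub_val @` A, csub_val @` B) => /=.
    split; [apply: filterS GA|apply: filterS GB] => x Ax /=; by exists x.
  move=> [_ _] /= [[x Ax <-] [y By <-]].
  by have := AB (x, y) (conj Ax By); rewrite -!ball_normE.
pose l := lim (csub_val @ G).
have Gl : csub_val @ G --> l by exact: cauchy_cvg.
have Yl : csub_set Y l.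
  refine (@closed_cvg _ _ G PG csub_val (csub_set Y) (@csub_closed Y) _ l Gl).
  by apply: nearW => x; apply/set_mem; case: x.
have Yl' : l \in in_csub by exact: mem_set.
apply/cvg_ex; exists (Csub Yl').
by apply/cvgrPdist_lt => e e0; move/cvgrPdist_lt: Gl => /(_ e e0).
Qed.

HB.instance Definition _ := Uniform_isComplete.Build csub csub_cauchy_cvg.

Lemma csub_val_bounded_linear : csub_val \in bounded_linear.
Proof. by apply/asboolP; split=> // r; exists r. Qed.

Definition csub_incl : 'L(csub, E) := BoundedOperator csub_val_bounded_linear.

End closed_subspaces.

Section l1.
Context (R : realType).

Definition abs_series (u : nat -> R^o) : nat -> R := series (fun n => `|u n|).

Definition summable_seq : {pred nat -> R^o} :=
  fun u => `[< cvgn (abs_series u) >].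

Lemma le_normed_series (u : nat -> R^o) n :
  cvgn (abs_series u) -> abs_series u n <= limn (abs_series u).
Proof.
move=> cu; apply: nondecreasing_cvgn_le => //.
by apply: nondecreasing_series => i _ _; exact: normr_ge0.
Qed.

Lemma normed_series_cvg (u : nat -> R^o) (M : R) :
  (forall n, abs_series u n <= M) -> cvgn (abs_series u).
Proof.
move=> uM; apply: nondecreasing_is_cvgn.
  by apply: nondecreasing_series => i _ _; exact: normr_ge0.
by exists M => _ [n _ <-].
Qed.

Lemma le_normed_seriesD (u v : nat -> R^o) n :
  abs_series (u + v) n <= abs_series u n + abs_series v n.
Proof. by rewrite /abs_series /series /= -big_split /= ler_sum// => i _; exact: ler_normD. Qed.

Lemma normed_seriesZ (a : R) (u : nat -> R^o) n :
  abs_series (a *: u) n = `|a| * abs_series u n.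
Proof.
by rewrite /abs_series /series /= mulr_sumr; apply: eq_bigr => i _; exact: normrM.
Qed.

Lemma summable_seq_submod_closed : submod_closed summable_seq.
Proof.
split; first apply/asboolP.
  apply: (@normed_series_cvg _ 0) => n.
  by rewrite /abs_series /series /= big1// => i _; exact: normr0.
move=> a u v /asboolP cu /asboolP cv; apply/asboolP.
apply: (@normed_series_cvg _
  (`|a| * limn (abs_series u) + limn (abs_series v))) => n.
rewrite (le_trans (le_normed_seriesD _ _ _))// normed_seriesZ.
by rewrite lerD ?ler_wpM2l ?le_normed_series.
Qed.

HB.instance Definition _ :=
  GRing.isSubmodClosed.Build R (nat -> R^o) summable_seq
    summable_seq_submod_closed.

Record l1 := L1 { l1_seq :> nat -> R^o; _ : l1_seq \in summable_seq }.

HB.instance Definition _ := [isSub for l1_seq].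
HB.instance Definition _ := [Choice of l1 by <:].
HB.instance Definition _ := [SubChoice_isSubLmodule of l1 by <:].

Definition l1_norm (u : l1) : R := limn (abs_series u).

Lemma l1_cvg (u : l1) : cvgn (abs_series u).
Proof. by case: u => u /= /asboolP. Qed.

Lemma l1_normD u v : l1_norm (u + v) <= l1_norm u + l1_norm v.
Proof.
apply: limr_le; first exact: l1_cvg.
apply: nearW => n; rewrite (le_trans (le_normed_seriesD u v n))//.
by rewrite lerD ?le_normed_series//; exact: l1_cvg.
Qed.

Lemma l1_normZ (a : R) u : l1_norm (a *: u) = `|a| * l1_norm u.
Proof.
apply/cvg_lim => //.
rewrite (_ : abs_series _ = fun n => `|a| * abs_series u n).
  by apply: cvgMr; exact: (@l1_cvg u).
by apply/funext => n; exact: normed_seriesZ.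
Qed.

Lemma l1_norm0_eq0 u : l1_norm u = 0 -> u = 0.
Proof.
move=> u0; apply/val_inj/funext => n; apply/eqP; rewrite -normr_le0.
have := @le_normed_series u n.+1 (@l1_cvg u); rewrite -/(l1_norm u) u0.
rewrite /abs_series /series /= big_nat_recr//=; apply: le_trans.
by rewrite lerDr sumr_ge0.
Qed.

HB.instance Definition _ :=
  Lmodule_isNormed.Build R l1 l1_normD l1_normZ l1_norm0_eq0.

Lemma l1_unit_summable n :
  (fun m => (m == n)%:R : R^o) \in summable_seq.
Proof.
apply/asboolP/(@normed_series_cvg _ 1) => k; rewrite /abs_series /series /=.
have [kn|nk] := leqP k n.
  rewrite big_nat big1// => i /andP[_ ik].
  by rewrite ltn_eqF ?normr0// (leq_trans ik).
rewrite (bigD1_seq n) ?mem_index_iota ?iota_uniq//= eqxx normr1 big1 ?addr0//.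
by move=> i /negbTE ->; rewrite normr0.
Qed.

Definition l1_unit n : l1 := L1 (l1_unit_summable n).

End l1.

Section banach_notions.
Context {R : realType}.

Definition infinite_dim (E : normedModType R) :=
  ~ exists n (b : 'I_n -> E), forall x, exists c : 'I_n -> R,
      x = \sum_i c i *: b i.

Definition separable (E : normedModType R) :=
  exists D : set E, countable D /\ dense D.

(* Surjectivity of the canonical embedding of [E] into its bidual. *)
Definition reflexive_space (E : normedModType R) :=
  forall phi : 'L('L(E, R^o), R^o),
    exists x : E, forall f : 'L(E, R^o), phi f = f x.

Definition schauder_basis (E : normedModType R) (e : nat -> E) :=
  forall x : E, exists! a : nat -> R, series (fun n => a n *: e n) @ \oo --> x.

Definition lin_span (E : normedModType R) (e : nat -> E) : set E :=
  [set x | exists n (a : nat -> R), x = \sum_(i < n) a i *: e i].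

(* A Schauder basis of its closed linear span. *)
Definition basic_sequence (E : normedModType R) (e : nat -> E) :=
  forall x, closure (lin_span e) x ->
    exists! a : nat -> R, series (fun n => a n *: e n) @ \oo --> x.

Definition weakly_null (E : normedModType R) (x : nat -> E) :=
  forall f : 'L(E, R^o), f (x n) @[n --> \oo] --> (0 : R^o).

Definition generates_spreading_model (E F : normedModType R)
    (x : nat -> E) (e : nat -> F) :=
  [/\ bounded_fun x, basic_sequence e &
    forall (k : nat) (eps : R), 0 < eps -> \forall N \near \oo,
      forall (n : 'I_k -> nat) (a : 'I_k -> R),
        (forall j, (N <= n j)%N) -> {homo n : i j / (i < j)%N} ->
        (forall j, -1 <= a j <= 1) ->
        `| `|\sum_j a j *: x (n j)| - `|\sum_j a j *: e j| | < eps].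

Definition compact_operator (E F : normedModType R) (T : 'L(E, F)) :=
  precompact (T @` [set x | `|x| <= 1]).

Definition iso_onto_range (E F : normedModType R) (T : 'L(E, F)) :=
  exists2 G : F -> E, cancel T G & {within range T, continuous G}.

Definition strictly_singular (E : completeNormedModType R)
    (F : normedModType R) (S : 'L(E, F)) :=
  forall Z : closed_subspace E, infinite_dim (csub Z) ->
    ~ iso_onto_range (S \oL csub_incl Z).

(* [Z] is the algebraic direct sum of [Y] and [W], and the projection of [Z]
   onto [Y] along [W] is bounded. *)
Definition topological_direct_sum (E : completeNormedModType R)
    (Z Y W : closed_subspace E) :=
  [/\ (Z : set E) = [set y + w | y in Y & w in W],
      Y `&` W = [set 0] &
      exists C : R, forall y w, csub_set Y y -> csub_set W w -> `|y| <= C * `|y + w| ].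

Definition hereditarily_indecomposable (E : completeNormedModType R) :=
  forall Z : closed_subspace E, infinite_dim (csub Z) ->
    ~ exists Y W : closed_subspace E,
        [/\ infinite_dim (csub Y), infinite_dim (csub W) &
            topological_direct_sum Z Y W].

(* A semigroup is indexed by all of [R]; its values at negative times are
   irrelevant. *)
Definition c0_semigroup (E : normedModType R) (T : R -> 'L(E, E)) :=
  [/\ T 0 = idop E,
      forall s t, 0 <= s -> 0 <= t -> T (t + s) = T t \oL T s &
      forall x, `|T t x - x| @[t --> 0^'+] --> (0 : R)].

Definition uniformly_continuous_semigroup (E : normedModType R)
    (T : R -> 'L(E, E)) :=
  `|T t - idop E| @[t --> 0^'+] --> (0 : R).

Definition lotz (E : normedModType R) :=
  forall T : R -> 'L(E, E),
    c0_semigroup T -> uniformly_continuous_semigroup T.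

Definition lotz_saturated (E : completeNormedModType R) :=
  forall Y : closed_subspace E, infinite_dim (csub Y) ->
    exists Z : closed_subspace E,
      [/\ Z `<=` Y, infinite_dim (csub Z) & lotz (csub Z)].

End banach_notions.

(* Main.v *)
Require Import Defs.
From HB Require Import structures.
From mathcomp Require Import all_boot all_order all_algebra.
From mathcomp Require Import boolp classical_sets functions reals topology.
From mathcomp Require Import normedtype sequences exp.
From mathcomp Require Import ring lra zify.

Set Implicit Arguments.
Unset Strict Implicit.
Unset Printing Implicit Defensive.

Import Order.TTheory GRing.Theory Num.Theory.
Import numFieldNormedType.Exports.

Local Open Scope classical_set_scope.
Local Open Scope ring_scope.

(** The space is not Lotz because it has a Schauder basis. If [S_n] are the
    partial sum projections of a basis [e], then multiplying the [m]-th
    coordinate by [exp (- m t)] defines a strongly continuous semigroup: with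
    [r = exp (- t)] this multiplier is the Abel mean
    [(1 - r) \sum_n r ^ n S_(n+1)], so it is bounded in terms of the basis
    constant ([schauder_coordinates], [abel_mean]). At every [t > 0] it moves a
    basis vector of large index by almost its whole norm, so the semigroup is
    not uniformly continuous ([basis_not_lotz]).

    For saturation, every infinite dimensional closed subspace [Y] is shown to
    contain a closed subspace [Z] on which no bounded sequence of compact
    operators converges strongly to the identity. Such a [Z] has the Lotz
    property ([lotz_of_no_compact_approximation]). The means [V_h] of a
    semigroup over the intervals [0, h] are a scalar plus a strictly singular
    operator, whose cube is compact, and they converge strongly to the identity.
    If the scalar vanished for arbitrarily small [h], then the compact operators
    [V_h ^ 3] would contradict the choice of [Z]. If it does not vanish for some
    [h], then [V_h] has a right inverse modulo compact operators, and since the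
    semigroup is Lipschitz on the range of [V_h] it is uniformly continuous
    ([uniformly_continuous_of_parametrix]).

    The subspace [Z] comes from a construction of Enflo, Davie and Szankowski. A
    weakly null sequence with spreading model l1 yields in [Y], through a
    gliding hump along the basis, vectors in finite blocks such that the l1 norm
    of the coefficients in each block is controlled by the norm of any
    combination ([block_l1_system]). Inside a block, Rademacher functions
    produce vectors [e k], indexed by bit strings [k] of a fixed length, which
    behave like an orthonormal system among strings with the same label, and
    whose coordinate functionals are jointly bounded among strings with
    different labels ([string_system]). [Z] is spanned by the vectors [z w], the
    difference of [e] at the two children of [w] plus the sum of [e] at its four
    grandchildren. The coefficient of [z w] can be read at the children or at
    the grandchildren. Hence the averages over the strings [w] of length [n] of
    the coefficient of [T (z w)] at [z w] form a sequence whose consecutive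
    differences are pairings of coordinates at [k] with vectors in which [e k]
    has been cancelled. The labels are arranged so that, on large sets of
    strings, the coordinates involved have different labels while the vectors
    they are paired with fall into nine families with equal labels. Averaging
    over signs then shows that the differences decay geometrically
    ([trace_mean_diff]). The averages are therefore uniformly convergent on
    bounded sets of operators, tend to zero on compact operators, and equal one
    at the identity ([no_compact_approximation]). *)

(** * Sequences and bounded operators *)

Lemma seq_cvgP {R : realType} {E : normedModType R} (u : nat -> E) (l : E) :
  u @ \oo --> l <->
  forall eps : R, 0 < eps -> exists N, forall n, (N <= n)%N -> `|u n - l| <= eps.
Proof.
split=> [/cvgrPdist_le ul eps e0|H].
  have [N _ HN] := ul eps e0; exists N => n Nn.
  by rewrite distrC; exact: HN.
apply/cvgrPdist_le => eps e0; have [N HN] := H eps e0.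
by exists N => // n Nn; rewrite distrC; exact: HN.
Qed.

Lemma seq_cauchy_cvg {R : realType} {E : completeNormedModType R}
    (u : nat -> E) :
  (forall eps : R, 0 < eps -> exists N, forall m n, (N <= m)%N -> (N <= n)%N ->
     `|u m - u n| <= eps) ->
  exists l : E, u @ \oo --> l.
Proof.
move=> H; suff uc : cauchy (u @ \oo) by apply/cvg_ex; exact: cauchy_cvg.
apply/cauchy_ballP => eps e0.
have e20 : 0 < eps / 2 by lra.
have [N HN] := H _ e20.
exists (u @` [set n | (N <= n)%N], u @` [set n | (N <= n)%N]) => /=.
  by split; exists N => // n Nn; exists n.
move=> [_ _] /= [[m Nm <-] [n Nn <-]]; rewrite -ball_normE /=.
by apply: le_lt_trans (HN _ _ Nm Nn) _; lra.
Qed.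

Section operators.
Context {R : realType}.

HB.instance Definition _ (E F : normedModType R) (f : 'L(E, F)) :=
  GRing.isLinear.Build R E F *:%R (opfun f) (@op_linear R E F f).

Implicit Types E F : normedModType R.

Lemma bounded_linear_of_le E F (f : E -> F) (C : R) :
  linear f -> (forall x, `|f x| <= C * `|x|) -> f \in bounded_linear.
Proof.
move=> lf fC; apply/asboolP; split=> // r; exists (`|C| * `|r|) => x xr.
apply: le_trans (fC x) _; apply: (le_trans (ler_norm _)).
by rewrite normrM normr_id ler_wpM2l// (le_trans xr)// ler_norm.
Qed.

Lemma opB E F (f : 'L(E, F)) x y : f (x - y) = f x - f y.
Proof. exact: linearB. Qed.

Lemma op_sumE E F (I : Type) (r : seq I) (P : pred I) (f : I -> 'L(E, F)) x :
  (\sum_(i <- r | P i) f i) x = \sum_(i <- r | P i) f i x.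
Proof. by apply: (big_morph (fun g : 'L(E, F) => g x)). Qed.

Lemma le_op E F (f : 'L(E, F)) x : `|f x| <= `|f| * `|x|.
Proof. exact: le_opnorm. Qed.

Lemma opnorm_le_of E F (f : 'L(E, F)) (C : R) : 0 <= C ->
  (forall x, `|f x| <= C * `|x|) -> `|f| <= C.
Proof.
move=> C0 fC; apply: opnorm_le => x x1; apply: le_trans (fC x) _.
by rewrite -[leRHS]mulr1 ler_wpM2l.
Qed.

Lemma op_cvg E F (f : 'L(E, F)) (u : nat -> E) (l : E) :
  u @ \oo --> l -> (f \o u) @ \oo --> f l.
Proof.
move=> /seq_cvgP ul; apply/seq_cvgP => eps e0.
have fp : 0 < `|f| + 1 by rewrite ltr_wpDl.
have [|N HN] := ul (eps / (`|f| + 1)); first by rewrite divr_gt0.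
exists N => n /HN ln; rewrite /= -linearB.
apply: le_trans (le_op _ _) _.
apply: (@le_trans _ _ ((`|f| + 1) * `|u n - l|)).
  by rewrite ler_wpM2r// lerDl.
by rewrite mulrC -ler_pdivlMr.
Qed.

Lemma op_strong_limit E F (A : nat -> 'L(E, F)) (C : R) :
  (forall n x, `|A n x| <= C * `|x|) ->
  (forall x, exists l : F, A^~ x @ \oo --> l) ->
  exists V : 'L(E, F), forall x,
    A^~ x @ \oo --> V x /\ `|V x| <= C * `|x|.
Proof.
move=> AC /choice[V AV].
have VC x : `|V x| <= C * `|x|.
  have nV : (fun n => `|A n x|) @ \oo --> `|V x| by apply: cvg_norm; exact: AV.
  rewrite -(cvg_lim _ nV)//; apply: limr_le; first by apply/cvg_ex; exists `|V x|.
  by apply: nearW => n; exact: AC.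
have Vlin : linear V.
  move=> a x y.
  have H : (fun n => A n (a *: x + y)) @ \oo --> a *: V x + V y.
    rewrite (_ : (fun n => _) = (fun n => a *: A n x + A n y)).
      apply: cvgD; last exact: AV.
      by apply: cvgZl_tmp; exact: AV.
    by apply/funext => n; rewrite linearP.
  exact: (cvg_unique _ (AV _) H).
exists (BoundedOperator (bounded_linear_of_le Vlin VC)) => x.
by split; [exact: AV|exact: VC].
Qed.

End operators.

Lemma half_expn_small {R : realType} (c eps : R) : 0 < eps ->
  exists n, c * 2^-1 ^+ n <= eps.
Proof.
move=> e0.
have : (fun n => c * 2^-1 ^+ n) @ \oo --> c * (0 : R).
  apply: cvgMl_tmp; apply: cvg_expr; rewrite ger0_norm; lra.
rewrite mulr0 => /seq_cvgP/(_ _ e0)[N /(_ N (leqnn N))].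
by rewrite subr0 => H; exists N; apply: le_trans H; exact: ler_norm.
Qed.

Lemma geometric_cvg {R : realType} {E : completeNormedModType R}
    (u : nat -> E) (c : R) :
  (forall n, `|u n.+1 - u n| <= c * 2^-1 ^+ n) ->
  exists l : E, u @ \oo --> l /\ forall n, `|u n - l| <= 2 * c * 2^-1 ^+ n.
Proof.
move=> H.
have c0 : 0 <= c by have := H 0; rewrite expr0 mulr1; apply: le_trans.
have D n k : `|u (n + k)%N - u n| <= 2 * c * 2^-1 ^+ n * (1 - 2^-1 ^+ k).
  elim: k => [|k IH]; first by rewrite addn0 subrr normr0 expr0 subrr mulr0.
  rewrite addnS -(subrKA (u (n + k)%N)); apply: le_trans (ler_normD _ _) _.
  have := H (n + k)%N; move: IH; rewrite exprD exprS.
  by set A := _ ^+ n; set B := _ ^+ k; nra.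
have D' n k : `|u (n + k)%N - u n| <= 2 * c * 2^-1 ^+ n.
  apply: le_trans (D n k) _; rewrite ler_piMr//.
    by rewrite !mulr_ge0// exprn_ge0// invr_ge0.
  by rewrite lerBlDr lerDl exprn_ge0// invr_ge0.
have [l ul] : exists l : E, u @ \oo --> l.
  apply: seq_cauchy_cvg => eps e0.
  have [N HN] := half_expn_small (2 * (2 * c)) e0.
  exists N => m n /subnKC <- /subnKC <-.
  rewrite -(subrKA (u N)); apply: le_trans (ler_normD _ _) _.
  rewrite [X in _ + X]distrC.
  by have := D' N (m - N)%N; have := D' N (n - N)%N; lra.
exists l; split=> // n.
rewrite distrC; apply/ler_addgt0Pr => eps e0.
move/seq_cvgP: ul => /(_ _ e0)[N HN].
rewrite -(subrKA (u (n + N)%N)); apply: le_trans (ler_normD _ _) _.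
rewrite [X in X + _]distrC [leRHS]addrC; apply: lerD (D' _ _).
by apply: HN; exact: leq_addl.
Qed.

Lemma ler_dist3 {R : realType} {E : normedModType R} (a b c d : E) :
  `|a - d| <= `|a - b| + `|b - c| + `|c - d|.
Proof.
by apply: le_trans (ler_distD c _ _) _; rewrite lerD2r ler_distD.
Qed.

(** * Schauder bases *)

Section basis.
Context {R : realType} {X : completeNormedModType R}.
Variables (e : nat -> X).

(** The Baire category step of the open mapping theorem: some level set of the
    supremum of the [`|p x N|] is dense in a ball, and differences of its elements
    approximate all the vectors of a ball at the origin. *)
Lemma baire_half_approx (p : X -> nat -> X) :
  (forall N, linear (p^~ N)) ->
  (forall x, exists M, forall N, `|p x N| <= M) ->
  exists2 C : R, 0 <= C & forall x, exists y,
    `|x - y| <= 2^-1 * `|x| /\ forall N, `|p y N| <= C * `|x|.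
Proof.
move=> plin pbd.
have pB x y N : p (x - y) N = p x N - p y N.
  have := plin N (-1) y x; rewrite !scaleN1r => H.
  by rewrite addrC H addrC.
have pZ c x N : p (c *: x) N = c *: p x N.
  have p0 : p 0 N = 0 by have := pB 0 0 N; rewrite !subrr.
  by have := plin N c x 0; rewrite !addr0 p0 addr0.
pose A (m : nat) : set X := [set x | forall N, `|p x N| <= m%:R].
have [m [x0 [rho rho0 Hrho]]] : exists m x0, exists2 rho : R, 0 < rho &
    ball x0 rho `<=` closure (A m).
  apply: contrapT => nH.
  have : dense (\bigcap_m ~` closure (A m)).
    apply: Baire => m; split; first exact/closed_openC/closed_closure.
    move=> O [x0 Ox0] Oo; apply: contrapT => /set0P/negP/negPn/eqP O0.
    apply: nH; exists m, x0.
    have /nbhs_ballP[rho rho0 H] : nbhs x0 O by exact: open_nbhs_nbhs.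
    exists rho => // y /H Oy; apply: contrapT => ny.
    by have : (O `&` ~` closure (A m)) y by []; rewrite O0.
  move=> /(_ setT)[||x [_ Hx]]; [by exists 0|exact: openT|].
  have [M HM] := pbd x.
  have [m Mm] : exists m : nat, M <= m%:R.
    by exists (Num.bound `|M|); apply: ltW; apply: le_lt_trans (ler_norm _) _;
       rewrite archi_boundP.
  apply: (Hx m I); apply: subset_closure => N.
  exact: le_trans (HM N) Mm.
have app x eps : `|x| < rho -> 0 < eps -> exists y, `|x - y| <= eps /\
    forall N, `|p y N| <= 2 * m%:R.
  move=> xr e0; have e20 : 0 < eps / 2 by lra.
  have /Hrho/(_ (ball (x0 + x) (eps / 2)))[|y1 [Ay1 By1]] :
      ball x0 rho (x0 + x).
  - by rewrite -ball_normE /= opprD addrA subrr sub0r normrN.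
  - exact: nbhsx_ballx.
  have /Hrho/(_ (ball x0 (eps / 2)))[|y2 [Ay2 By2]] : ball x0 rho x0.
  - exact: ballxx.
  - exact: nbhsx_ballx.
  exists (y1 - y2); split.
    rewrite (_ : x - _ = (x0 + x - y1) - (x0 - y2)); last first.
      rewrite !opprB -!addrA [RHS]addrC -!addrA addNr addr0.
      by rewrite [y2 - _]addrC.
    apply: le_trans (ler_normB _ _) _; move: By1 By2.
    by rewrite -!ball_normE /= => ? ?; lra.
  move=> N; rewrite pB; apply: le_trans (ler_normB _ _) _.
  by have := Ay1 N; have := Ay2 N; lra.
(* Differences of elements of [A m] have partial sums bounded by [2 * m]; the given
   vector is scaled to norm [rho / 2]. *)
exists (2 * m%:R * (2 / rho)) => [|x].
  by rewrite !mulr_ge0// invr_ge0 ltW.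
have [->|x0n] := eqVneq x 0.
  exists 0; split=> [|N]; first by rewrite subr0 normr0 mulr0.
  have := pZ 0 0 N; rewrite !scale0r => ->.
  by rewrite !normr0 mulr0.
have nx : 0 < `|x| by rewrite normr_gt0.
pose t := rho / 2 / `|x|.
have t0 : 0 < t by rewrite !divr_gt0.
have tx : `|t *: x| = rho / 2.
  by rewrite normrZ gtr0_norm// /t divfK ?gt_eqF.
have [||y [xy py]] := app (t *: x) (rho / 4); [by rewrite tx; lra|lra|].
exists (t^-1 *: y); split.
  rewrite -[X in `|X - _|](scalerK (lt0r_neq0 t0)) -scalerBr.
  rewrite normrZ normfV gtr0_norm// mulrC ler_pdivrMr//.
  apply: le_trans xy _; rewrite /t le_eqVlt; apply/orP; left; apply/eqP.
  by field; rewrite gt_eqF.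
move=> N; rewrite pZ normrZ normfV gtr0_norm// mulrC ler_pdivrMr//.
apply: le_trans (py N) _; rewrite /t le_eqVlt; apply/orP; left; apply/eqP.
by field; rewrite !gt_eqF.
Qed.


(** Continuity of the coordinate functionals and boundedness of the partial sum
    projections.  Every vector is the sum of a geometric series of vectors with
    controlled partial sums; adding the expansions of the terms gives an
    expansion of the vector, which is the only one. *)
Lemma schauder_coordinates : schauder_basis e ->
  exists (a : nat -> 'L(X, R^o)) (K : R),
    [/\ 0 <= K,
        forall x, series (fun n => a n x *: e n) @ \oo --> x,
        forall m n, a m (e n) = (m == n)%:R &
        forall N x, `|series (fun n => a n x *: e n) N| <= K * `|x|].
Proof.
move=> be; have /choice[a aP] := be.
have a_cvg x : series (fun n => a x n *: e n) @ \oo --> x by have [] := aP x.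
have a_uniq x b : series (fun n => b n *: e n) @ \oo --> x -> b = a x.
  by move=> bx; have [_ H] := aP x; rewrite (H _ bx).
pose p x := series (fun n => a x n *: e n).
have aL c x y n : a (c *: x + y) n = c * a x n + a y n.
  rewrite -(a_uniq _ (fun n => c * a x n + a y n))//.
  rewrite (_ : series _ = (fun N => c *: p x N + p y N)).
    by apply: cvgD; [apply: cvgZl_tmp|]; exact: a_cvg.
  apply/funext => N; rewrite /p /series /= scaler_sumr -big_split /=.
  by apply: eq_bigr => i _; rewrite scalerDl scalerA.
have plin N : linear (p^~ N).
  move=> c x y; rewrite /p /series /= scaler_sumr -big_split /=.
  by apply: eq_bigr => i _; rewrite aL scalerDl scalerA.
have a0 n : a 0 n = 0.
  rewrite -(a_uniq _ (fun=> 0))//.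
  rewrite (_ : series _ = fun=> 0); first exact: cvg_cst.
  by apply/funext => N; rewrite /series /= big1// => i _; rewrite scale0r.
have seriesd m c N : (m < N)%N ->
    series (fun n => ((n == m)%:R * c n) *: e n) N = c m *: e m :> X.
  move=> mN; rewrite /series /= (bigD1_seq m) ?mem_index_iota ?iota_uniq//=.
  rewrite eqxx mul1r big1 ?addr0// => i /negbTE ->.
  by rewrite mul0r scale0r.
have ae m : a (e m) = fun n => (n == m)%:R.
  rewrite -(a_uniq _ (fun n => (n == m)%:R * (fun=> 1) n)).
    by apply/funext => n; rewrite mulr1.
  apply/seq_cvgP => eps e0; exists m.+1 => n mn.
  by rewrite (seriesd m (fun=> 1))// scale1r subrr normr0 ltW.
have e_neq0 m : e m != 0.
  apply/eqP => em; have := ae m; rewrite em => /(congr1 (@^~ m)).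
  by rewrite a0 eqxx => /eqP; rewrite eq_sym oner_eq0.
have pbd x : exists M, forall N, `|p x N| <= M.
  have /cvg_seq_bounded[M [_ HM]] : cvgn (p x) by apply/cvg_ex; exists x;
    exact: a_cvg.
  by exists (M + 1) => N; apply: HM => //; rewrite ltrDl.
have [C C0 HC] := baire_half_approx plin pbd.
have /choice[g gP] := HC.
have pS x n : p x n.+1 = p x n + a x n *: e n.
  by rewrite /p /series /= big_nat_recr.
have p_bound x N : `|p x N| <= 2 * C * `|x|.
  (* [r k] is the remainder after [k] approximations. *)
  pose r k := iter k (fun y => y - g y) x.
  have r_le k : `|r k| <= `|x| * 2^-1 ^+ k.
    elim: k => [|k IH]; first by rewrite expr0 mulr1.
    rewrite /r iterS; have [H _] := gP (r k); apply: le_trans H _.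
    by rewrite exprS mulrCA ler_wpM2l// invr_ge0.
  have pB y z n : p (y - z) n = p y n - p z n.
    have := plin n (-1) z y; rewrite /= !scaleN1r => H.
    by rewrite addrC H addrC.
  have step k n : `|p (x - r k.+1) n - p (x - r k) n| <=
      C * `|x| * 2^-1 ^+ k.
    rewrite -pB /r iterS -/(r k).
    have -> : x - (r k - g (r k)) = x - r k + g (r k).
      by rewrite opprB addrA addrAC.
    rewrite addrAC subrr add0r.
    have [_ H] := gP (r k); apply: le_trans (H n) _.
    by rewrite -mulrA ler_wpM2l.
  have /choice[b bP] n : exists b : R,
      (fun k => a (x - r k) n) @ \oo --> b.
    have en : 0 < `|e n| by rewrite normr_gt0.
    have [k|b [H _]] := @geometric_cvg R R^o (fun k => a (x - r k) n)
        (2 * C * `|x| / `|e n|).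
      rewrite [leRHS]mulrAC ler_pdivlMr// -normrZ scalerBl.
      have -> : a (x - r k.+1) n *: e n - a (x - r k) n *: e n =
         (p (x - r k.+1) n.+1 - p (x - r k) n.+1) -
         (p (x - r k.+1) n - p (x - r k) n).
        by rewrite !pS (opprD (p (x - r k) n)) addrACA [RHS]addrAC subrr add0r.
      apply: le_trans (ler_normB _ _) _.
      by have := step k n.+1; have := step k n; lra.
    by exists b.
  have pb n k : `|p (x - r k) n - series (fun n => b n *: e n) n| <=
      2 * (C * `|x|) * 2^-1 ^+ k.
    have [k'|l [H1 H2]] := @geometric_cvg R X (fun k => p (x - r k) n)
        (C * `|x|); first exact: step.
    suff <- : l = series (fun n => b n *: e n) n by exact: H2.
    apply: (cvg_unique _ H1); rewrite /p /series /=.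
      exact: norm_hausdorff.
    elim: n {H1 H2} => [|n IH].
      by rewrite big_geq// (_ : (fun k => _) = fun=> 0); [exact: cvg_cst|
        apply/funext => k'; rewrite big_geq].
    rewrite big_nat_recr//= (_ : (fun k => _) = (fun k =>
        \sum_(0 <= i < n) a (x - r k) i *: e i + a (x - r k) n *: e n)).
      by apply: cvgD => //; apply: cvgZr_tmp; exact: bP.
    by apply/funext => k'; rewrite big_nat_recr.
  have bx : series (fun n => b n *: e n) @ \oo --> x.
    apply/seq_cvgP => eps eps0; have e30 : 0 < eps / 3 by lra.
    have [k Hk] := half_expn_small (2 * (C * `|x|) + `|x|) e30.
    have /seq_cvgP/(_ _ e30)[M HM] := a_cvg (x - r k).
    exists M => n /HM Hn.
    apply: le_trans (ler_dist3 _ (p (x - r k) n) (x - r k) _) _.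
    rewrite [X in X + _ + _]distrC.
    have -> : x - r k - x = - r k by rewrite addrAC subrr sub0r.
    rewrite normrN; have := pb n k; have := r_le k; rewrite /p.
    by move: Hk Hn; set t := 2^-1 ^+ k; lra.
  have := pb N 0; rewrite expr0 mulr1 (a_uniq _ _ bx) /r /= subrr.
  rewrite (_ : p 0 N = 0) ?sub0r ?normrN ?mulrA//.
  by rewrite /p /series /= big1// => i _; rewrite a0 scale0r.
have a_bound n x : `|a x n| <= (4 * C / `|e n|) * `|x|.
  have en : 0 < `|e n| by rewrite normr_gt0.
  rewrite mulrAC ler_pdivlMr// -normrZ.
  have -> : a x n *: e n = p x n.+1 - p x n by rewrite pS addrC addKr.
  apply: le_trans (ler_normB _ _) _.
  by have := p_bound x n.+1; have := p_bound x n; lra.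
have alin n : linear ((fun x => a x n) : X -> R^o).
  by move=> c x y; rewrite aL.
exists (fun n => BoundedOperator (bounded_linear_of_le (@alin n) (@a_bound n))).
exists (2 * C); split=> //=; first by rewrite mulr_ge0.
  by move=> m n; rewrite ae.
by move=> N x; exact: p_bound.
Qed.

End basis.

(** * The diagonal semigroup of a Schauder basis *)

Lemma right0_cvgP {R : realType} (f : R -> R) : (forall t, 0 <= f t) ->
  f t @[t --> 0^'+] --> (0 : R) <->
  forall eps : R, 0 < eps -> exists2 d : R, 0 < d &
    forall t, 0 < t -> t < d -> f t <= eps.
Proof.
move=> f0; split=> [/cvgrPdist_le H eps e0|H].
  have := H eps e0; rewrite near_withinE near_simpl => /nbhs_ballP[d /= d0 Hd].
  exists d => // t t0 td; have := Hd t.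
  rewrite -ball_normE /= sub0r normrN gtr0_norm// => /(_ td t0).
  by rewrite sub0r normrN ger0_norm.
apply/cvgrPdist_le => eps e0; have [d d0 Hd] := H eps e0.
rewrite near_withinE near_simpl; apply/nbhs_ballP; exists d => //= t.
rewrite -ball_normE /= sub0r normrN => td t0.
by rewrite sub0r normrN ger0_norm// Hd// (le_lt_trans (ler_norm _)).
Qed.

Section diagonal_semigroup.
Context {R : realType} {X : completeNormedModType R}.
Variables (e : nat -> X) (a : nat -> 'L(X, R^o)) (K : R).
Hypotheses (K0 : 0 <= K)
  (a_cvg : forall x, series (fun n => a n x *: e n) @ \oo --> x)
  (ae : forall m n, a m (e n) = (m == n)%:R)
  (K_bound : forall N x, `|series (fun n => a n x *: e n) N| <= K * `|x|).

Lemma op_eq_on_basis (f g : 'L(X, X)) : (forall m, f (e m) = g (e m)) -> f = g.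
Proof.
move=> fg; apply: opP => x.
have fx := op_cvg (f := f) (@a_cvg x); have gx := op_cvg (f := g) (@a_cvg x).
rewrite (_ : f \o _ = g \o series (fun n => a n x *: e n)) in fx.
  exact: (cvg_unique (@norm_hausdorff _ _) fx gx).
apply/funext => N; rewrite /= /series /= !linear_sum.
by apply: eq_bigr => i _; rewrite /= !opZ fg.
Qed.

Lemma series_basis m N :
  series (fun n => a n (e m) *: e n) N = (m < N)%:R *: e m.
Proof.
rewrite /series /=; have [mN|Nm] := ltnP m N.
  rewrite (bigD1_seq m) ?mem_index_iota ?iota_uniq//= ae eqxx big1 ?addr0//.
  by move=> i /negbTE im; rewrite ae im scale0r.
rewrite scale0r big_nat_cond big1// => i /andP[/andP[_ iN] _].
by rewrite ae ltn_eqF ?scale0r// (leq_trans iN).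
Qed.

(** The multiplier [r ^+ m] is realised as the Abel mean
    [(1 - r) * \sum_n r ^+ n * S_(n+1)] of the partial sum projections, which
    converges absolutely. *)
Lemma abel_mean (r : R) : 0 <= r -> r <= 1 -> exists V : 'L(X, X),
  (forall x, `|V x| <= (K + 1) * `|x|) /\ forall m, V (e m) = r ^+ m *: e m.
Proof.
move=> r0; rewrite le_eqVlt => /predU1P[->|r1].
  exists (idop X); split=> [x|m]; first by rewrite ler_peMl// lerDr.
  by rewrite expr1n scale1r.
have Slin N : linear (fun x => series (fun n => a n x *: e n) N).
  move=> c x y; rewrite /series /= scaler_sumr -big_split /=.
  by apply: eq_bigr => i _; rewrite linearP scalerDl scalerA.
pose S N : 'L(X, X) := BoundedOperator (bounded_linear_of_le (Slin N) (K_bound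
  N)).
pose A N : 'L(X, X) := \sum_(0 <= n < N) ((1 - r) * r ^+ n) *: S n.+1.
have AE N x : A N x = \sum_(0 <= n < N) ((1 - r) * r ^+ n) *: S n.+1 x.
  by rewrite /A op_sumE.
have diff N k x : `|A (N + k)%N x - A N x| <= (r ^+ N - r ^+ (N + k)) * (K *
  `|x|).
  elim: k => [|k IH]; first by rewrite addn0 !subrr normr0 mul0r.
  rewrite addnS AE big_nat_recr//= -AE addrAC.
  apply: le_trans (ler_normD _ _) _; rewrite normrZ.
  have rn : 0 <= r ^+ (N + k) by rewrite exprn_ge0.
  rewrite ger0_norm ?mulr_ge0 ?subr_ge0 ?(ltW r1)//.
  have := ler_wpM2l (_ : 0 <= (1 - r) * r ^+ (N + k)) (K_bound (N + k).+1 x).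
  rewrite mulr_ge0 ?subr_ge0 ?(ltW r1)// => /(_ isT);
    rewrite [_ ^+ (N + k).+1]exprS.
  by move: IH; nra.
have Ab N x : `|A N x| <= (K + 1) * `|x|.
  have := diff 0 N x; rewrite add0n {2}/A big_geq// subr0 expr0 => H.
  apply: le_trans H _; have : 0 <= r ^+ N by rewrite exprn_ge0.
  have : 0 <= K * `|x| by rewrite mulr_ge0.
  by have := normr_ge0 x; nra.
have rcvg : (fun n => r ^+ n) @ \oo --> (0 : R).
  by apply: cvg_expr; rewrite ger0_norm.
have [x|V HV] := op_strong_limit Ab.
  apply: seq_cauchy_cvg => eps e0.
  have e20 : 0 < eps / (2 * (K * `|x| + 1)).
    by rewrite divr_gt0// mulr_gt0// ltr_wpDl// mulr_ge0.
  have /seq_cvgP/(_ _ e20)[N /(_ N (leqnn N))] := rcvg.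
  rewrite subr0 ger0_norm ?exprn_ge0//.
  have D0 : 0 <= K * `|x| by rewrite mulr_ge0.
  rewrite ler_pdivlMr; last by rewrite mulr_gt0// ltr_wpDl.
  move=> HN; exists N => m n /subnKC <- /subnKC <-.
  rewrite -(subrKA (A N x)); apply: le_trans (ler_normD _ _) _.
  rewrite [X in _ + X]distrC.
  have := diff N (m - N)%N x; have := diff N (n - N)%N x.
  have : 0 <= r ^+ (N + (m - N)) by rewrite exprn_ge0.
  have : 0 <= r ^+ (N + (n - N)) by rewrite exprn_ge0.
  have : 0 <= r ^+ N by rewrite exprn_ge0.
  by move: HN; nra.
exists V; split=> [x|m]; first by have [] := HV x.
have [Vm _] := HV (e m).
have Am k : A (m + k)%N (e m) = (r ^+ m - r ^+ (m + k)) *: e m.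
  elim: k => [|k IH].
    rewrite addn0 subrr scale0r AE big_nat_cond big1// => i.
    move=> /andP[/andP[_ im] _]; rewrite /= series_basis ltnNge im.
    by rewrite scale0r scaler0.
  rewrite addnS AE big_nat_recr//= -AE IH series_basis ltnS leq_addr scale1r.
  by rewrite -scalerDl exprS; congr (_ *: _); ring.
have H : A^~ (e m) @ \oo --> (r ^+ m - 0) *: e m.
  rewrite -(cvg_shiftn m); rewrite (_ : (fun n => _) = (fun k =>
    (r ^+ m - r ^+ (k + m)) *: e m)).
    apply: cvgZr_tmp; apply: cvgB; first exact: cvg_cst.
    by rewrite (cvg_shiftn m (fun k => r ^+ k)).
  by apply/funext => k; rewrite addnC Am.
by rewrite (cvg_unique (@norm_hausdorff _ _) Vm H) subr0.
Qed.

(** The semigroup law and the continuity at zero are checked on the basis; the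
    uniform bound carries the latter over to all vectors. *)
Lemma basis_not_lotz : ~ lotz X.
Proof.
move=> lX.
have /choice[V HV] (r : R) : exists V : 'L(X, X), 0 <= r -> r <= 1 ->
    (forall x, `|V x| <= (K + 1) * `|x|) /\ forall m, V (e m) = r ^+ m *: e m.
  have [r0|] := boolP (0 <= r); last by exists 0.
  have [r1|] := boolP (r <= 1); last by exists 0.
  by have [V HV] := abel_mean r0 r1; exists V.
pose T (t : R) := V (expR (- t)).
have e01 (t : R) : 0 <= t -> 0 <= expR (- t) /\ expR (- t) <= 1.
  by move=> t0; rewrite expR_ge0 -expR0 ler_expR oppr_le0.
have TK (t : R) x : 0 <= t -> `|T t x| <= (K + 1) * `|x|.
  by move=> /e01[r0 r1]; have [] := HV _ r0 r1.
have Te (t : R) m : 0 <= t -> T t (e m) = expR (- t) ^+ m *: e m.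
  by move=> /e01[r0 r1]; have [] := HV _ r0 r1.
have Te_sub (t : R) m : 0 <= t -> `|T t (e m) - e m| = (1 - expR (- t) ^+ m) *
  `|e m|.
  move=> t0; have [r0 r1] := e01 t t0.
  rewrite Te// -[X in _ - X]scale1r -scalerBl normrZ distrC ger0_norm//.
  by rewrite subr_ge0 exprn_ile1.
have sgT : c0_semigroup T.
  split.
  - apply: op_eq_on_basis => m; rewrite Te//= oppr0 expR0 expr1n scale1r.
    by [].
  - move=> s t s0 t0; apply: op_eq_on_basis => m.
    rewrite /= !Te ?addr_ge0// linearZ /= Te// scalerA -exprMn mulrC.
    by rewrite opprD expRD.
  move=> x; apply/right0_cvgP => [t|eps e0]; first exact: normr_ge0.
  pose c := eps / (2 * (K + 2)).
  have c0 : 0 < c by rewrite divr_gt0// mulr_gt0// ltr_wpDl.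
  have /seq_cvgP/(_ _ c0)[N /(_ N (leqnn N))] := @a_cvg x.
  set y := series _ N => xy.
  have [B B0 HB] : exists2 B : R, 0 <= B & forall t, 0 <= t ->
    `|T t y - y| <= t * B.
    rewrite /y {y xy} /series /=; elim: N => [|N [B B0 IH]].
      by exists 0 => // t t0; rewrite big_geq// linear0 subr0 normr0 mulr0.
    exists (B + `|a N x| * (N%:R * `|e N|));
      first by rewrite addr_ge0// !mulr_ge0.
    move=> t t0; rewrite big_nat_recr//= linearD opprD addrACA.
    apply: le_trans (ler_normD _ _) _; rewrite mulrDr; apply: lerD;
      first exact: IH.
    rewrite /= opZ -scalerBr normrZ Te_sub// [leRHS]mulrCA ler_wpM2l//.
    rewrite mulrA ler_wpM2r//.
    have [r0 r1] := e01 t t0.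
    have : 1 - N%:R * (1 - expR (- t)) <= expR (- t) ^+ N.
      elim: N {B B0 IH} => [|N IH]; first by rewrite mul0r subr0 expr0.
      rewrite exprS -[N.+1%:R]natr1; have := ler_wpM2l r0 IH.
      have : 0 <= N%:R * (1 - expR (- t)) ^+ 2 by rewrite mulr_ge0// sqr_ge0.
      by set u := expR (- t); set v := _ ^+ N; nra.
    have := expR_ge1Dx (- t); have := ler0n R N.
    by set u := expR (- t); set v := _ ^+ N; nra.
  exists (eps / (2 * (B + 1))); first by rewrite divr_gt0// mulr_gt0// ltr_wpDl.
  move=> t t0 td; apply: le_trans (ler_dist3 _ (T t y) y _) _.
  rewrite -linearB /=; have := HB t (ltW t0).
  have := TK t (x - y) (ltW t0); rewrite [`|x - y|]distrC.
  move: xy; rewrite ler_pdivlMr; last by rewrite mulr_gt0// ltr_wpDl.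
  move: td; rewrite ltr_pdivlMr; last by rewrite mulr_gt0// ltr_wpDl.
  by have := normr_ge0 (y - x); nra.
have /right0_cvgP := lX _ sgT.
have n0 t : 0 <= `|T t - idop X| by exact: normr_ge0.
move=> /(_ n0 2^-1)[|d d0 Hd]; first by rewrite invr_gt0.
have d20 : 0 < d / 2 by rewrite divr_gt0.
have [|r0 r1] := e01 (d / 2); first exact: ltW.
have r1' : expR (- (d / 2)) < 1 by rewrite expR_lt1 oppr_lt0.
have : (fun n => expR (- (d / 2)) ^+ n) @ \oo --> (0 : R).
  by apply: cvg_expr; rewrite ger0_norm.
move=> /seq_cvgP/(_ (1 / 4))[|m /(_ m (leqnn m))]; first by rewrite divr_gt0.
rewrite subr0 ger0_norm ?exprn_ge0// => rm.
have em : 0 < `|e m|.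
  rewrite normr_gt0; apply/eqP => em; have := ae m m; rewrite em linear0 eqxx.
  by move=> /eqP; rewrite eq_sym oner_eq0.
have := le_op (T (d / 2) - idop X) (e m).
have -> : (T (d / 2) - idop X) (e m) = T (d / 2) (e m) - e m by [].
rewrite Te_sub; last exact: ltW.
have := Hd _ d20; have -> : d / 2 < d by lra.
move=> /(_ isT); set u := `|_ - _|; set v := _ ^+ m in rm *; nra.
Qed.

End diagonal_semigroup.

(** * Strongly continuous semigroups *)

Lemma compact_operator_net {R : realType} {E F : normedModType R}
    (T : 'L(E, F)) : compact_operator T ->
  forall eps : R, 0 < eps -> exists s : seq F,
    forall x, `|x| <= 1 -> exists2 y, y \in s & `|T x - y| <= eps.
Proof.
rewrite /compact_operator precompactE compact_cover => cT eps e0.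
have [y _|y yT|D _ HD] := cT F setT (fun y => ball y eps).
- exact: ball_open.
- by exists y => //; exact: ballxx.
exists (finmap.enum_fset D) => x x1.
have [|y yD] := HD (T x); first by apply: subset_closure; exists x.
rewrite -ball_normE /= distrC => /ltW Txy.
by exists y.
Qed.

Section semigroup.
Context {R : realType} {E : completeNormedModType R}.
Variable T : R -> 'L(E, E).
Hypothesis sgT : c0_semigroup T.

Lemma semigroup0 x : T 0 x = x.
Proof. by case: sgT => ->. Qed.

Lemma semigroupD s t x : 0 <= s -> 0 <= t -> T (t + s) x = T t (T s x).
Proof. by move=> s0 t0; case: sgT => _ -> //. Qed.

Lemma semigroup_cvg0 x (eps : R) : 0 < eps -> exists2 d : R, 0 < d &
  forall t, 0 <= t -> t < d -> `|T t x - x| <= eps.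
Proof.
move=> e0; have [_ _ /(_ x)/right0_cvgP] := sgT.
move=> /(_ (fun=> normr_ge0 _) _ e0)[d d0 Hd]; exists d => // t.
rewrite le_eqVlt => /predU1P[<- _|t0 td]; last exact: Hd.
by rewrite semigroup0 subrr normr0 ltW.
Qed.

(** Otherwise operators at times tending to zero would be unbounded, while they
    converge strongly. *)
Lemma semigroup_locally_bounded : exists M eta : R,
  [/\ 1 <= M, 0 < eta & forall t x, 0 <= t -> t <= eta -> `|T t x| <= M * `|x|].
Proof.
apply: contrapT => nH.
have /choice[tx Htx] (n : nat) : exists tx : R * E,
    [/\ 0 <= tx.1, tx.1 <= n.+1%:R^-1 & n.+1%:R * `|tx.2| < `|T tx.1 tx.2| ].
  apply: contrapT => Hn; apply: nH; exists n.+1%:R, n.+1%:R^-1; split.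
  - by rewrite ler1n.
  - by rewrite invr_gt0.
  - by move=> t x t0 tn; rewrite leNgt; apply/negP => H; apply: Hn; exists (t, x).
pose F : set (E -> E) := [set f | exists n, f = opfun (T (tx n).1)].
have [|x|M HM] := @Banach_Steinhauss R E E F _ _ 1.
- by move=> _ [n ->]; split; [exact: op_bounded|exact: op_linear].
- have /cvg_seq_bounded[M [_ HM]] : cvgn (fun n => T (tx n).1 x).
    apply/cvg_ex; exists x; apply/seq_cvgP => eps e0.
    have [d d0 Hd] := semigroup_cvg0 x e0.
    exists (Num.bound d^-1) => n Nn; have [t0 tn _] := Htx n.
    apply: Hd => //; apply: le_lt_trans tn _.
    rewrite invf_plt ?posrE//; apply: lt_le_trans (archi_boundP _) _.
      by rewrite invr_ge0 ltW.
    by rewrite ler_nat (leq_trans Nn).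
  by exists (M + 1) => _ [n ->]; apply: HM => //; rewrite ltrDl.
pose n := Num.bound `|M|; have [_ _] := Htx n; apply/negP; rewrite -leNgt.
apply: le_trans (le_op _ _) _; rewrite ler_wpM2r//.
apply: opnorm_le => y y1; apply: (@le_trans _ _ M).
  by apply: HM => //; exists n.
apply: (le_trans (ler_norm _)); apply/ltW/(lt_le_trans (archi_boundP _)) => //.
by rewrite ler_nat.
Qed.

Section mean.
Variables (M h : R).
Hypotheses (M1 : 1 <= M) (h0 : 0 < h)
  (TM : forall t x, 0 <= t -> t <= 2 * h -> `|T t x| <= M * `|x|).

Definition riemann_mean (N : nat) : 'L(E, E) :=
  N%:R^-1 *: \sum_(0 <= j < N) T (j%:R * (h / N%:R)).

Lemma riemann_meanE N x :
  riemann_mean N x = N%:R^-1 *: \sum_(0 <= j < N) T (j%:R * (h / N%:R)) x.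
Proof.
have -> : riemann_mean N x =
  N%:R^-1 *: (\sum_(0 <= j < N) T (j%:R * (h / N%:R))) x by [].
by rewrite op_sumE.
Qed.

Lemma norm_mean_le (N : nat) (f : nat -> E) (c : R) : (0 < N)%N ->
  (forall j, (j < N)%N -> `|f j| <= c) ->
  `|N%:R^-1 *: \sum_(0 <= j < N) f j| <= c.
Proof.
move=> N0 fc; rewrite normrZ ger0_norm ?invr_ge0// ler_pdivrMl ?ltr0n//.
apply: le_trans (ler_norm_sum _ _ _) _.
rewrite mulr_natl -[X in c *+ X]subn0 -sumr_const_nat !big_nat.
by apply: ler_sum => j /andP[_]; exact: fc.
Qed.

Lemma mean_cst (N : nat) (x : E) : (0 < N)%N ->
  N%:R^-1 *: \sum_(0 <= j < N) x = x.
Proof.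
move=> N0; rewrite sumr_const_nat subn0 -[x *+ N]scaler_nat scalerA mulVf
  ?scale1r//.
by rewrite pnatr_eq0 -lt0n.
Qed.

Lemma mesh_ge0 N : 0 <= h / N%:R.
Proof. by rewrite divr_ge0// ltW. Qed.

Lemma mesh_le N j : (0 < N)%N -> (j <= N)%N -> j%:R * (h / N%:R) <= h.
Proof.
move=> N0 jN; rewrite mulrA ler_pdivrMr ?ltr0n// mulrC ler_wpM2l ?ler_nat//.
exact: ltW.
Qed.

Lemma node_ge0 N j : 0 <= j%:R * (h / N%:R).
Proof. by rewrite mulr_ge0// mesh_ge0. Qed.

Lemma riemann_mean_le N x : (0 < N)%N -> `|riemann_mean N x| <= M * `|x|.
Proof.
move=> N0; rewrite riemann_meanE; apply: norm_mean_le => // j jN.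
apply: TM; first exact: node_ge0.
by have := mesh_le N0 (ltnW jN); have := ltW h0; lra.
Qed.

Lemma big_nat_blocks (F : nat -> E) m n :
  \sum_(0 <= i < m * n) F i = \sum_(0 <= j < m) \sum_(0 <= i < n) F (j * n + i)%N.
Proof.
elim: m => [|m IH]; first by rewrite mul0n !big_geq.
rewrite big_nat_recr//= -IH mulSn addnC (big_cat_nat (n := m * n))//=; last first.
  exact: leq_addr.
congr (_ + _); rewrite -{1}[(m * n)%N]add0n big_addn addKn.
by apply: eq_bigr => i _; rewrite addnC.
Qed.

(** Refining the subdivision replaces each sample by a mean over a short
    interval. *)
Lemma riemann_mean_refine m n x (eps : R) : (0 < m)%N -> (0 < n)%N ->
  (forall t, 0 <= t -> t <= h / m%:R -> `|T t x - x| <= eps) ->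
  `|riemann_mean (m * n) x - riemann_mean m x| <= M * eps.
Proof.
move=> m0 n0 Hx.
have mR : m%:R != 0 :> R by rewrite pnatr_eq0 -lt0n.
have nR : n%:R != 0 :> R by rewrite pnatr_eq0 -lt0n.
have -> : riemann_mean (m * n) x - riemann_mean m x = m%:R^-1 *:
    \sum_(0 <= j < m) T (j%:R * (h / m%:R))
       (n%:R^-1 *: \sum_(0 <= i < n) (T (i%:R * (h / m%:R / n%:R)) x - x)).
  rewrite !riemann_meanE big_nat_blocks natrM invfM -scalerA -scalerBr.
  congr (_ *: _); rewrite scaler_sumr -sumrB; apply: eq_bigr => j _.
  rewrite sumrB scalerBr mean_cst// linearB /=; congr (_ - _).
  rewrite [RHS]opZ.
  congr (_ *: _).
  rewrite linear_sum; apply: eq_bigr => i _ /=.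
  rewrite -semigroupD ?node_ge0//; last first.
    by rewrite mulr_ge0// divr_ge0// mesh_ge0.
  by congr (T _ x); rewrite natrD natrM; field; rewrite mR nR.
apply: norm_mean_le => // j jm; apply: le_trans (TM _ _ _) _.
- exact: node_ge0.
- by have := mesh_le m0 (ltnW jm); have := ltW h0; lra.
rewrite ler_wpM2l//; first exact: le_trans M1.
apply: norm_mean_le => // i ni; apply: Hx.
  by rewrite mulr_ge0// divr_ge0// mesh_ge0.
rewrite mulrCA ler_piMr ?mesh_ge0// ler_pdivrMr ?ltr0n// mul1r ler_nat.
exact: ltnW.
Qed.

(** Shifting the sample points by [t] changes only a proportion [t / h] of them
    at each end of the interval. *)
Lemma riemann_mean_shift N x (t eps : R) : (0 < N)%N -> 0 <= t -> t <= h ->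
  (forall s, 0 <= s -> s <= h / N%:R -> `|T s x - x| <= eps) ->
  `|T t (riemann_mean N x) - riemann_mean N x| <=
    2 * M * (t / h) * `|x| + M * (M * eps).
Proof.
move=> N0 t0 th Hx.
have NR : 0 < N%:R :> R by rewrite ltr0n.
have M0 : 0 <= M by exact: le_trans M1.
pose d := h / N%:R; have d0 : 0 < d by rewrite divr_gt0.
pose m := Num.truncn (t / d).
have /andP[mt tm] : m%:R <= t / d < m.+1%:R.
  by apply: truncn_itv; rewrite divr_ge0// ltW.
rewrite ler_pdivlMr// in mt; rewrite ltr_pdivrMr// in tm.
pose r := t - m%:R * d.
have r0 : 0 <= r by rewrite subr_ge0.
have rd : r <= d by rewrite /r; move: tm; rewrite -natr1; lra.
have mN : (m <= N)%N.
  rewrite -(ler_nat R) -(ler_pM2r d0) (le_trans mt)// (le_trans th)//.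
  by rewrite /d mulrC divfK// gt_eqF.
have md0 : 0 <= m%:R * d by rewrite mulr_ge0// ltW.
have md2 : m%:R * d <= 2 * h by have := mesh_le N0 mN; rewrite -/d; lra.
set y := riemann_mean N x.
apply: le_trans (ler_distD (T (m%:R * d) y) _ _) _; rewrite addrC; apply: lerD.
  have -> : T (m%:R * d) y - y = N%:R^-1 *:
      (\sum_(N <= j < N + m) T (j%:R * d) x - \sum_(0 <= j < m) T (j%:R * d) x).
    rewrite /y riemann_meanE opZ linear_sum /= -scalerBr; congr (_ *: _).
    transitivity (\sum_(m <= j < N + m) T (j%:R * d) x -
        \sum_(0 <= j < N) T (j%:R * d) x).
      congr (_ - _); have -> : \sum_(m <= j < N + m) T (j%:R * d) x =
          \sum_(0 <= j < N) T ((j + m)%:R * d) x.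
        by rewrite -{1}[m]add0n big_addn addnK.
      apply: eq_bigr => j _; rewrite -semigroupD// ?node_ge0//.
      by rewrite natrD mulrDl addrC.
    rewrite (big_cat_nat (n := m) (m := 0))//= (big_cat_nat (n := N) (m := m))//=.
      by rewrite [X in _ - X]addrC opprD addrACA subrr add0r.
    exact: leq_addr.
  have b2 j : (j <= N + m)%N -> `|T (j%:R * d) x| <= M * `|x|.
    move=> jm; apply: TM; first by rewrite mulr_ge0// ltW.
    apply: (@le_trans _ _ ((N + N)%:R * d)).
      by rewrite ler_wpM2r ?(ltW d0)// ler_nat (leq_trans jm)// leq_add2l.
    by rewrite natrD mulrDl /d mulrCA mulfV ?gt_eqF//; lra.
  rewrite normrZ ger0_norm ?invr_ge0 ?(ltW NR)// ler_pdivrMl//.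
  apply: le_trans (ler_normB _ _) _.
  apply: (@le_trans _ _ (m%:R * (M * `|x|) + m%:R * (M * `|x|))).
    apply: lerD; apply: le_trans (ler_norm_sum _ _ _) _.
      rewrite [leRHS]mulr_natl -[X in _ *+ X](addKn N) -sumr_const_nat !big_nat.
      by apply: ler_sum => j /andP[_ /ltnW]; exact: b2.
    rewrite [leRHS]mulr_natl -[X in _ *+ X]subn0 -sumr_const_nat !big_nat.
    apply: ler_sum => j /andP[_ /ltnW jm]; apply: b2.
    by rewrite (leq_trans jm)// leq_addl.
  have Mx : 0 <= M * `|x| by rewrite mulr_ge0.
  have : m%:R <= N%:R * (t / h).
    rewrite mulrA ler_pdivlMr// -ler_pdivrMl// mulrCA (mulrC _ h) -/d.
    exact: mt.
  by nra.
have -> : T t y - T (m%:R * d) y = T (m%:R * d) (T r y - y).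
  rewrite linearB /= -semigroupD//.
  by congr (T _ _ - _); rewrite /r addrC subrK.
apply: le_trans (TM _ md0 md2) _; rewrite ler_wpM2l//.
have -> : T r y - y = riemann_mean N (T r x - x).
  rewrite linearB -[RHS]/(riemann_mean N (T r x) - riemann_mean N x) /y.
  congr (_ - _); rewrite !riemann_meanE opZ linear_sum /=.
  congr (_ *: _); apply: eq_bigr => j _.
  by rewrite -!semigroupD ?node_ge0// addrC.
apply: le_trans (riemann_mean_le _ N0) _; rewrite ler_wpM2l//.
exact: Hx.
Qed.

(** [V] is the mean [h^-1 * \int_0^h T(s) ds], obtained as the limit of its dyadic
    Riemann sums. *)
Lemma integral_mean : exists V : 'L(E, E),
  [/\ forall x, `|V x| <= M * `|x|,
      forall x (eps : R), (forall t, 0 <= t -> t <= h -> `|T t x - x| <= eps) ->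
        `|V x - x| <= eps &
      forall t x, 0 <= t -> t <= h ->
        `|T t (V x) - V x| <= 2 * M * (t / h) * `|x| ].
Proof.
have M0 : 0 < M by exact: lt_le_trans M1.
have p2 k : (0 < 2 ^ k)%N by rewrite expn_gt0.
pose A k := riemann_mean (2 ^ k).
have small x eps : 0 < eps -> exists k0, forall k, (k0 <= k)%N ->
    forall t, 0 <= t -> t <= h / (2 ^ k)%:R -> `|T t x - x| <= eps.
  move=> /(semigroup_cvg0 x)[d d0 Hd].
  have [k0 Hk] := half_expn_small h (divr_gt0 d0 (ltr0Sn R 1)).
  exists k0 => k kk t t0 tk; apply: Hd => //; apply: le_lt_trans tk _.
  apply: (@le_lt_trans _ _ (d / 2)); last by lra.
  apply: le_trans Hk; rewrite ler_wpM2l ?(ltW h0)// natrX -exprVn.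
  by rewrite ler_wiXn2l// ?invr_ge0// invf_le1// ler1n.
have Acvg x : exists l : E, A^~ x @ \oo --> l.
  apply: seq_cauchy_cvg => eps e0.
  have e20 : 0 < eps / (2 * M) by rewrite divr_gt0// mulr_gt0.
  have [N HN] := small x _ e20; exists N => m n.
  have D k : `|A (N + k)%N x - A N x| <= eps / 2.
    apply: le_trans (_ : _ <= M * (eps / (2 * M))) _; last first.
      by rewrite le_eqVlt; apply/orP; left; apply/eqP; field; rewrite gt_eqF.
    by rewrite /A expnD; apply: riemann_mean_refine => //; exact: HN.
  move=> /subnKC <- /subnKC <-; rewrite -(subrKA (A N x)).
  apply: le_trans (ler_normD _ _) _; rewrite [X in _ + X]distrC.
  by have := D (m - N)%N; have := D (n - N)%N; lra.
have [//|V HV] := op_strong_limit (fun k x => riemann_mean_le x (p2 k)).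
exists V; split=> [x|x eps Hx|t x t0 th]; first by have [] := HV x.
- have [Vx _] := HV x.
  have H : (fun k => `|A k x - x|) @ \oo --> `|V x - x|.
    by apply: cvg_norm; apply: cvgB => //; exact: cvg_cst.
  rewrite -(cvg_lim _ H)//; apply: limr_le; first by apply/cvg_ex; eexists;
    exact: H.
  apply: nearW => k.
  have -> : A k x - x = (2 ^ k)%:R^-1 *: \sum_(0 <= j < 2 ^ k)
      (T (j%:R * (h / (2 ^ k)%:R)) x - x).
    by rewrite /A riemann_meanE sumrB scalerBr mean_cst.
  apply: norm_mean_le => // j jk; apply: Hx; first exact: node_ge0.
  exact/mesh_le/ltnW.
have [Vx _] := HV x.
apply/ler_addgt0Pr => eps e0.
have e20 : 0 < eps / (M * M) by rewrite divr_gt0// mulr_gt0.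
have [k0 Hk0] := small x _ e20.
have H : (fun k => `|T t (A k x) - A k x|) @ \oo --> `|T t (V x) - V x|.
  apply: cvg_norm; apply: cvgB => //.
  exact: (op_cvg (f := T t) Vx).
rewrite -(cvg_lim _ H)//; apply: limr_le; first by apply/cvg_ex; eexists;
  exact: H.
exists k0 => // k kk.
have := riemann_mean_shift (p2 k) t0 th (Hk0 k kk).
have -> // : M * (M * (eps / (M * M))) = eps.
by field; rewrite gt_eqF.
Qed.

End mean.

(** Every vector lies in the range of [V] up to an element of a finite net of the
    image of [K] and a remainder of norm at most one half.  The semigroup is
    Lipschitz on the range and continuous at each point of the net, and the
    contribution of the remainder is absorbed by the left hand side. *)
Lemma uniformly_continuous_of_parametrix (V B K : 'L(E, E)) (h c k : R) :
  0 < h -> 0 <= c ->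
  (forall t x, 0 <= t -> t <= h -> `|T t (V x) - V x| <= c * t * `|x|) ->
  compact_operator K -> (forall x, V (B x) = x + k *: K x) ->
  uniformly_continuous_semigroup T.
Proof.
move=> h0 c0 HV cK VB; apply/right0_cvgP => [t|eps e0]; first exact: normr_ge0.
have k0 : 0 < `|k| + 1 by rewrite ltr_wpDl.
have [|s Hs] := compact_operator_net cK (_ : 0 < (2 * (`|k| + 1))^-1).
  by rewrite invr_gt0 mulr_gt0.
have [d d0 Hd] : exists2 d : R, 0 < d & forall t, 0 <= t -> t < d ->
    forall y, y \in s -> `|T t (k *: y) - k *: y| <= eps / 4.
  elim: s {Hs} => [|y s [d d0 Hd]]; first by exists 1.
  have e40 : 0 < eps / 4 by rewrite divr_gt0.
  have [d' d'0 Hd'] := semigroup_cvg0 (k *: y) e40.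
  exists (Num.min d d') => [|t t0]; first by rewrite lt_min d0.
  rewrite lt_min => /andP[td td'] z; rewrite inE => /predU1P[->|];
    first exact: Hd'.
  exact: Hd.
have cB : 0 < 4 * (c * `|B| + 1).
  by rewrite mulr_gt0// ltr_wpDl// mulr_ge0.
exists (Num.min (Num.min d h) (eps / (4 * (c * `|B| + 1)))).
  by rewrite !lt_min d0 h0 divr_gt0.
move=> t t0; rewrite !lt_min => /andP[/andP[td th]]; rewrite ltr_pdivlMr// => te.
suff : `|T t - idop E| <= eps / 2 + 2^-1 * `|T t - idop E| by lra.
apply: opnorm_le => x x1.
have [y ys Kxy] := Hs x x1.
have xE : x = V (B x) - k *: y + k *: (y - K x).
  by rewrite VB scalerBr addrA subrK addrK.
have -> : (T t - idop E) x = T t x - x by [].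
set u := k *: (y - K x) in xE.
have -> : T t x - x = (T t (V (B x)) - V (B x)) - (T t (k *: y) - k *: y) +
    (T t - idop E) u.
  have -> : (T t - idop E) u = T t u - u by [].
  have -> : T t x = T t (V (B x)) - T t (k *: y) + T t u.
    by rewrite {1}xE linearD linearB.
  rewrite [X in _ - X]xE opprD addrACA; congr (_ + _).
  by rewrite !opprB (AC (2*2) ((1*4)*(3*2))).
apply: le_trans (ler_normD _ _) _; apply: lerD.
  apply: le_trans (ler_normB _ _) _.
  have := Hd t (ltW t0) td y ys.
  have := HV t (B x) (ltW t0) (ltW th).
  have : c * t * `|B x| <= c * t * `|B|.
    rewrite ler_wpM2l//; first by rewrite mulr_ge0// ltW.
    by apply: opnorm_ub.
  move: te; rewrite mulrC; have := ltW t0; nra.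
apply: le_trans (le_op _ _) _; rewrite mulrC ler_wpM2r//.
rewrite normrZ distrC.
apply: (@le_trans _ _ ((`|k| + 1) * (2 * (`|k| + 1))^-1)).
  by apply: ler_pM => //; rewrite lerDl.
by rewrite invfM mulrCA mulfV ?gt_eqF// mulr1.
Qed.

End semigroup.

(** The means of a semigroup over short intervals converge strongly to the identity.
    They cannot all have scalar part zero, since their cubes would be compact; and a
    mean [V = alpha + S] with [alpha <> 0] satisfies
    [V * (alpha ^ 2 - alpha * S + S ^ 2) = alpha ^ 3 + S ^ 3]. *)
Lemma lotz_of_no_compact_approximation {R : realType}
    {E : completeNormedModType R} :
  (forall V : 'L(E, E), exists (alpha : R) (S : 'L(E, E)),
     compact_operator (S \oL S \oL S) /\ V = alpha *: idop E + S) ->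
  (forall (K : nat -> 'L(E, E)) (M : R), (forall n, compact_operator (K n)) ->
     (forall n x, `|K n x| <= M * `|x|) -> ~ forall x, K^~ x @ \oo --> x) ->
  lotz E.
Proof.
move=> scalar_plus no_approx T sgT.
have [M [eta [M1 eta0 TM]]] := semigroup_locally_bounded sgT.
have M0 : 0 <= M by exact: le_trans M1.
pose h (n : nat) : R := eta / 2 / n.+1%:R.
have h0 n : 0 < h n by rewrite !divr_gt0.
have h_le n : h n <= eta / 2.
  by rewrite ler_pdivrMr// ler_peMr ?ler1n// divr_ge0// ltW.
have h2 n : 2 * h n <= eta by have := h_le n; lra.
have [V HV] := choice (fun n => integral_mean sgT M1 (h0 n)
  (fun t x t0 th => TM t x t0 (le_trans th (h2 n)))).
have [al Hal] := choice (fun n => scalar_plus (V n)).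
have [[n aln]|al0] := pselect (exists n, al n != 0).
  have [S [cS VS]] := Hal n; have [_ _ HVn] := HV n.
  pose B : 'L(E, E) := (al n ^- 3) *: (al n ^+ 2 *: idop E - al n *: S + S \oL S).
  apply: (@uniformly_continuous_of_parametrix R E T sgT (V n) B (S \oL S \oL S)
    (h n) (2 * M / h n) (al n ^- 3)) => //.
  - by apply: divr_ge0; [rewrite mulr_ge0|exact: ltW].
  - move=> t x t0 th; apply: le_trans (HVn t x t0 th) _.
    by rewrite mulrA [_ * t / _]mulrAC.
  - move=> x; rewrite VS /B.
    have -> : (al n *: idop E + S) (B x) = al n *: B x + S (B x) by [].
    have -> : B x = al n ^- 3 *: (al n ^+ 2 *: x - al n *: S x + S (S x)) by [].
    rewrite opZ scalerA mulrC -scalerA -scalerDr.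
    rewrite [X in _ + X]linearD [X in _ + (X + _)]linearB /= !opZ.
    rewrite [al n *: (_ - _ + _)]scalerDr [al n *: (_ - _)]scalerBr.
    rewrite ![al n *: (_ *: _)]scalerA -!exprS -expr2 (AC (3*3)
      ((1*6)*((2*4)*(3*5)))).
    by rewrite /= addNr subrr !addr0 scalerDr scalerA mulVf ?expf_neq0// scale1r.
exfalso.
have VE n : compact_operator (V n \oL V n \oL V n).
  have [S [cS ->]] := Hal n; have -> : al n = 0.
    by apply/eqP; apply: contrapT => /negP an; apply: al0; exists n.
  by rewrite scale0r add0r.
apply: (no_approx (fun n => V n \oL V n \oL V n) (M * (M * M))) => //.
  move=> n x; have [VM _ _] := HV n; rewrite /= -!mulrA.
  apply: le_trans (VM _) _; rewrite ler_wpM2l//.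
  apply: le_trans (VM _) _; rewrite ler_wpM2l//.
move=> x; apply/seq_cvgP => eps e0.
have M30 : 0 < M * M + M + 1 by rewrite ltr_wpDl// addr_ge0// mulr_ge0.
have [|d d0 Hd] := semigroup_cvg0 sgT x (_ : 0 < eps / (M * M + M + 1)).
  by rewrite divr_gt0.
exists (Num.bound (eta / 2 / d)) => n Nn.
have hd : h n < d.
  rewrite ltr_pdivrMr// [d * _]mulrC -ltr_pdivrMr//.
  apply: lt_le_trans (archi_boundP _) _; first by rewrite !divr_ge0 ?(ltW d0)
    ?(ltW eta0).
  by rewrite ler_nat (leq_trans Nn).
have [VM Vx _] := HV n.
have {}Vx : `|V n x - x| <= eps / (M * M + M + 1).
  by apply: Vx => t t0 th; apply: Hd => //; exact: le_lt_trans hd.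
rewrite /=; apply: le_trans (ler_dist3 _ (V n (V n x)) (V n x) _) _.
rewrite -!linearB /=.
have H1 := VM (V n x - x); have H2 := VM (V n (V n x - x)).
move: Vx; rewrite ler_pdivlMr//; move: H1 H2.
set u := `|V n x - x|; set v := `|V n (V n x - x)|; set w := `|V n (V n _)|.
by nra.
Qed.

(** * Finite dimensional copies of l1 in a subspace *)

Lemma exists_argmax {R : realType} (A : nat -> R) M : (0 < M)%N ->
  exists2 n, (n < M)%N & forall L, (L < M)%N -> A L <= A n.
Proof.
elim: M => // -[_ _|M IH _]; first by exists 0 => // -[].
have [//|n nM Hn] := IH.
have [An|An] := leP (A M.+1) (A n).
  exists n => [|L]; first exact: ltnW.
  by rewrite ltnS leq_eqVlt => /predU1P[->|/Hn].
exists M.+1 => // L; rewrite ltnS leq_eqVlt => /predU1P[->//|/Hn LA].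
exact: le_trans LA (ltW An).
Qed.

Lemma sum_half_powers {R : realType} M :
  \sum_(0 <= i < M) (2^-1 : R) ^+ i <= 2.
Proof.
suff : \sum_(0 <= i < M) (2^-1 : R) ^+ i = 2 - 2 * 2^-1 ^+ M.
  by move=> ->; rewrite lerBlDr lerDl mulr_ge0// exprn_ge0// invr_ge0.
elim: M => [|M IH]; first by rewrite big_geq// expr0 mulr1 subrr.
by rewrite big_nat_recr//= IH exprS; field.
Qed.

Lemma l1_norm_ge {R : realType} k (b : 'I_k -> R) :
  \sum_j `|b j| <= `| \sum_j b j *: l1_unit R j |.
Proof.
set u := \sum_j b j *: _.
have uE n : u n = \sum_j b j * (n == j :> nat)%:R.
  rewrite /u; elim/big_rec2: _ => // j y v _ <-.
  by [].
have := @le_normed_series R u k (@l1_cvg R u).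
rewrite /abs_series /series /= big_mkord (eq_bigr (fun j => `|b j|))// => j _.
rewrite uE (bigD1 j)//= eqxx mulr1 big1 ?addr0// => i ij.
by rewrite (_ : (j == i :> nat) = false) ?mulr0//; rewrite eq_sym; exact/negbTE.
Qed.

(** Coefficients with absolute values summing to one lie in the range where the
    spreading model approximates the norm, and there an error of one half leaves a
    lower bound of one half. *)
Lemma spreading_l1_lower {R : realType} {E : normedModType R} (x : nat -> E) :
  generates_spreading_model x (@l1_unit R) ->
  forall k, exists s0, forall s (c : nat -> R), (s0 <= s)%N ->
    \sum_(0 <= j < k) `|c j| <= 2 * `|\sum_(0 <= j < k) c j *: x (s + j)%N|.
Proof.
move=> [_ _ H] k; have h0 : 0 < 2^-1 :> R by rewrite invr_gt0.
have [s0 _ Hs] := H k _ h0.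
exists s0 => s c s0s; rewrite !big_mkord; set m := \sum_(j < k) `|c j|.
have m_ge0 : 0 <= m by rewrite sumr_ge0.
have [->|m0] := eqVneq m 0; first by rewrite mulr_ge0.
have mp : 0 < m by rewrite lt0r m0.
have mono : {homo (fun j : 'I_k => (s + j)%N) : i j / (i < j)%N}.
  by move=> i j; rewrite ltn_add2l.
have c1 (j : 'I_k) : -1 <= m^-1 * c j <= 1.
  rewrite -ler_norml normrM normfV (ger0_norm m_ge0) ler_pdivrMl// mulr1.
  by rewrite /m (bigD1 j)//= lerDl sumr_ge0.
have := Hs s s0s _ _ (fun j : 'I_k => leq_addr j s) mono c1.
have := l1_norm_ge (fun j : 'I_k => m^-1 * c j).
rewrite (eq_bigr (fun j : 'I_k => m^-1 * `|c j|)); last first.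
  by move=> j _; rewrite normrM normfV (ger0_norm m_ge0).
rewrite -mulr_sumr -/m mulVf// => H1.
rewrite (eq_bigr (fun j : 'I_k => m^-1 *: (c j *: x (s + j)%N))); last first.
  by move=> j _; rewrite scalerA.
rewrite -scaler_sumr normrZ normfV (ger0_norm m_ge0).
set w := `|\sum_(i < k) _ *: l1_unit R i| in H1 *.
rewrite ltr_distl => /andP[H2 _].
have : 2^-1 < m^-1 * `|\sum_(i < k) c i *: x (s + i)%N| by lra.
by rewrite mulrC ltr_pdivlMr// => H3; lra.
Qed.

Section block_l1.
Context {R : realType} {X : completeNormedModType R}.
Variables (e : nat -> X) (a : nat -> 'L(X, R^o)) (K : R).
Hypotheses (a_cvg : forall x, series (fun n => a n x *: e n) @ \oo --> x)
  (K_bound : forall N x, `|series (fun n => a n x *: e n) N| <= K * `|x|).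

Let S N x : X := series (fun n => a n x *: e n) N.

Let S_lin N : linear (S N).
Proof.
move=> c x y; rewrite /S /series /= scaler_sumr -big_split /=.
by apply: eq_bigr => i _; rewrite linearP scalerDl scalerA.
Qed.

Variables (Y : closed_subspace X) (x : nat -> csub Y).
Hypotheses (x_norm : forall n, `|x n| = 1) (x_null : weakly_null x)
  (x_l1 : generates_spreading_model x (@l1_unit R)).

Lemma partial_sum_null m (d : R) : 0 < d -> exists s, forall j, (s <= j)%N ->
  forall m', (m' <= m)%N -> `|S m' (csub_val (x j))| <= d.
Proof.
move=> d0; suff [s Hs] : exists s, forall j, (s <= j)%N ->
    \sum_(0 <= n < m) `|a n (csub_val (x j)) *: e n| <= d.
  exists s => j sj m' m'm; apply: le_trans (ler_norm_sum _ _ _) _.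
  apply: le_trans (Hs j sj); rewrite (big_cat_nat (n := m') (p := m))//=.
  by rewrite lerDl sumr_ge0.
elim: m d d0 => [|m IH] d d0; first by exists 0 => j _; rewrite big_geq// ltW.
have d20 : 0 < d / 2 by rewrite divr_gt0.
have [s Hs] := IH _ d20.
have e1 : 0 < `|e m| + 1 by rewrite ltr_wpDl.
have := x_null (a m \oL csub_incl Y).
move=> /seq_cvgP/(_ _ (divr_gt0 d20 e1))[s' Hs'].
exists (maxn s s') => j; rewrite geq_max => /andP[sj s'j].
rewrite big_nat_recr//=; have := Hs j sj; have := Hs' j s'j.
rewrite subr0 /= ler_pdivlMr// normrZ.
by have := normr_ge0 (a m (csub_val (x j))); have := normr_ge0 (e m); nra.
Qed.

Lemma partial_sum_tail t (d : R) : 0 < d -> exists m, forall j, (j < t)%N ->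
  forall m', (m <= m')%N -> `|S m' (csub_val (x j)) - csub_val (x j)| <= d.
Proof.
move=> d0; elim: t => [|t [m Hm]]; first by exists 0.
have /seq_cvgP/(_ _ d0)[m1 Hm1] := @a_cvg (csub_val (x t)).
exists (maxn m m1) => j; rewrite ltnS leq_eqVlt => /predU1P[->|jt] m'.
  by rewrite geq_max => /andP[_]; exact: Hm1.
by rewrite geq_max => /andP[mm' _]; exact: Hm.
Qed.

(** Gliding hump: the [n]-th block of vectors is almost supported, with respect
    to the basis, on an interval of its own.  If the largest block sum of
    coefficients occurs in block [n], then the projection onto the [n]-th interval
    recovers that block up to a quarter of its size. *)
Lemma block_l1_system (N : nat -> nat) :
  exists (u : nat -> nat -> X),
    (forall L i, csub_set Y (u L i) /\ `|u L i| <= 1) /\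
    forall M (c : nat -> nat -> R) n, (n < M)%N ->
      \sum_(0 <= i < N n) `|c n i| <=
      8 * K * `|\sum_(0 <= L < M) \sum_(0 <= i < N L) c L i *: u L i|.
Proof.
(* The total error of all blocks is then a quarter of the largest block sum. *)
pose d (n : nat) : R := 2^-1 ^+ n / 16.
have d0 n : 0 < d n by rewrite divr_gt0// exprn_gt0// invr_gt0.
have dS n : d n.+1 <= d n.
  by have := d0 n; rewrite /d exprS; lra.
have /choice[A HA] (mtn : nat * nat * nat) : exists s, [/\ (mtn.1.2 <= s)%N,
      forall j, (s <= j)%N -> forall m', (m' <= mtn.1.1)%N ->
        `|S m' (csub_val (x j))| <= d mtn.2 &
      forall c : nat -> R, \sum_(0 <= j < N mtn.2) `|c j| <=
        2 * `|\sum_(0 <= j < N mtn.2) c j *: x (s + j)%N|].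
  case: mtn => -[m t] n /=.
  have [s Hs] := partial_sum_null m (d0 n).
  have [s0 Hs0] := spreading_l1_lower x_l1 (N n).
  exists (maxn t (maxn s s0)); split; first exact: leq_maxl.
  - by move=> j; rewrite !geq_max => /and3P[_ sj _]; exact: Hs.
  - by move=> c; apply: Hs0; rewrite maxnA leq_maxr.
have /choice[B HB] (tn : nat * nat) : exists m, forall j, (j < tn.1)%N ->
    forall m', (m <= m')%N -> `|S m' (csub_val (x j)) - csub_val (x j)| <= d tn.2.
  by case: tn => t n; exact: partial_sum_tail.
(* The two components are the basis index from which the [n]-th interval starts, and
   the index in [x] from which the [n]-th block starts. *)
pose st := fix st n : nat * nat := if n is n'.+1 then
    let t := ((st n').2 + N n')%N in
    let m := maxn (st n').1 (B (t, n)) in (m, A (m, t, n))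
  else (0, A (0, 0, 0)).
pose m n := (st n).1; pose s n := (st n).2.
have m_mono : {homo m : i j / (i <= j)%N}.
  by apply: homo_leq => [i|i j k|i]; [exact: leqnn|exact: leq_trans|exact:
    leq_maxl].
have sE n : exists t, s n = A (m n, t, n).
  by case: n => [|n]; [exists 0|exists (s n + N n)%N].
have P1 n j : (s n <= j)%N -> forall m', (m' <= m n)%N ->
  `|S m' (csub_val (x j))| <= d n.
  by have [t ->] := sE n; have [_ H _] := HA (m n, t, n); exact: H.
have P2 n j : (j < s n + N n)%N -> forall m', (m n.+1 <= m')%N ->
    `|S m' (csub_val (x j)) - csub_val (x j)| <= d n.
  move=> jn m' mm'; apply: le_trans (dS n).
  apply: (HB (s n + N n, n.+1)%N) => //.
  by apply: leq_trans mm'; exact: leq_maxr.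
have P3 n (c : nat -> R) : \sum_(0 <= j < N n) `|c j| <=
    2 * `|\sum_(0 <= j < N n) c j *: csub_val (x (s n + j)%N)|.
  have sumE : csub_incl Y (\sum_(0 <= j < N n) c j *: x (s n + j)%N) =
      \sum_(0 <= j < N n) c j *: csub_val (x (s n + j)%N).
    by rewrite linear_sum.
  rewrite -sumE; have [t ->] := sE n.
  by have [_ _] := HA (m n, t, n); exact.
exists (fun L i => csub_val (x (s L + i)%N)); split=> [L i|M c n nM].
  split; last by rewrite -[`|_|]/(`|x (s L + i)%N|) x_norm.
  by apply/set_mem; case: (x _).
pose v L := \sum_(0 <= i < N L) c L i *: csub_val (x (s L + i)%N).
pose Al L := \sum_(0 <= i < N L) `|c L i|.
have Al0 L : 0 <= Al L by rewrite sumr_ge0.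
have [n0 n0M Hn0] := @exists_argmax _ Al M (leq_ltn_trans (leq0n n) nM).
apply: le_trans (Hn0 _ nM) _; rewrite -/(Al n0).
set V := \sum_(0 <= L < M) _.
pose Q y := S (m n0.+1) y - S (m n0) y.
have Qlin : linear Q.
  by move=> k y z; rewrite /Q !S_lin opprD addrACA -scalerBr.
have Q0 : Q 0 = 0 by have := Qlin (-1) 0 0; rewrite !scaleN1r !addNr.
have Qsum (I : Type) (r : seq I) (k : I -> R) (y : I -> X) :
    Q (\sum_(i <- r) k i *: y i) = \sum_(i <- r) k i *: Q (y i).
  elim: r => [|i r IH]; first by rewrite !big_nil.
  by rewrite !big_cons Qlin IH.
have Qv L : `|(L == n0)%:R *: v L - Q (v L)| <= 2 * d L * Al L.
  rewrite /v Qsum scaler_sumr -sumrB mulr_sumr.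
  apply: le_trans (ler_norm_sum _ _ _) _; rewrite !big_nat;
    apply: ler_sum => i /andP[_ iN].
  rewrite scalerA [_ * c _ _]mulrC -scalerA -scalerBr normrZ mulrC ler_wpM2r//.
  rewrite /Q; set j := (s L + i)%N.
  have jN : (j < s L + N L)%N by rewrite ltn_add2l.
  have js : (s L <= j)%N by exact: leq_addr.
  have [Ln|Ln|Ln] := ltngtP L n0.
  - rewrite scale0r sub0r normrN.
    rewrite -(subrKA (csub_val (x j))); apply: le_trans (ler_normD _ _) _.
    rewrite [X in _ + X]distrC.
    have := P2 L j jN (m n0.+1) (m_mono _ _ (leqW Ln)).
    have := P2 L j jN (m n0) (m_mono _ _ Ln).
    by lra.
  - rewrite scale0r sub0r normrN; apply: le_trans (ler_normB _ _) _.
    have := P1 L j js (m n0.+1) (m_mono _ _ Ln).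
    have := P1 L j js (m n0) (m_mono _ _ (ltnW Ln)).
    by lra.
  - rewrite -Ln scale1r.
    have -> : csub_val (x j) - (S (m L.+1) (csub_val (x j)) - S (m L) (csub_val
      (x j))) =
        S (m L) (csub_val (x j)) - (S (m L.+1) (csub_val (x j)) - csub_val (x j)).
      by rewrite !opprB addrCA.
    apply: le_trans (ler_normB _ _) _.
    have := P1 L j js (m L) (leqnn _).
    by have := P2 L j jN (m L.+1) (leqnn _); lra.
have vn0 : Al n0 <= 2 * `|v n0| by exact: P3.
have vV : v n0 - Q V = \sum_(0 <= L < M) ((L == n0)%:R *: v L - Q (v L)).
  rewrite sumrB (bigD1_seq n0) ?mem_index_iota ?iota_uniq//= eqxx scale1r.
  rewrite big1 ?addr0 => [|i /negbTE ->]; last by rewrite scale0r.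
  have QD y z : Q (y + z) = Q y + Q z by rewrite -{1}[y]scale1r Qlin scale1r.
  by rewrite -(big_morph Q QD Q0).
have vQ : `|v n0 - Q V| <= Al n0 / 4.
  rewrite vV; apply: le_trans (ler_norm_sum _ _ _) _.
  apply: (@le_trans _ _ (\sum_(0 <= L < M) (Al n0 / 8) * 2^-1 ^+ L)).
    rewrite !big_nat; apply: ler_sum => L /andP[_ LM]; apply: le_trans (Qv L) _.
    rewrite /d; have := Hn0 _ LM; have : 0 <= (2^-1 : R) ^+ L.
      by rewrite exprn_ge0// invr_ge0.
    by move: (2^-1 ^+ L) => t; nra.
  rewrite -mulr_sumr; have := @sum_half_powers R M; have := Al0 n0.
  by move: (\sum_(0 <= i < M) _) => t; nra.
have QV : `|Q V| <= 2 * K * `|V|.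
  apply: le_trans (ler_normB _ _) _.
  by have := K_bound (m n0.+1) V; have := K_bound (m n0) V; rewrite /S; lra.
have : `|v n0| <= `|v n0 - Q V| + `|Q V|.
  by rewrite -{1}[v n0](subrK (Q V)) ler_normD.
by move: vn0 vQ QV; lra.
Qed.

End block_l1.

(** * Random signs *)

Section rademacher.
Context {R : realType} (I : finType).
Implicit Types (i j : I) (w : {ffun I -> bool}) (A : {set I}).

Let N : R := #|{ffun I -> bool}|%:R.

Let N_gt0 : 0 < N.
Proof. by rewrite ltr0n; apply/card_gt0P; exists [ffun=> true]. Qed.

Lemma sign_orthogonality i j :
  \sum_(w : {ffun I -> bool}) (-1) ^+ w i * (-1) ^+ w j = N * (i == j)%:R.
Proof.
have [<-|ij] := eqVneq i j.
  rewrite mulr1 (eq_bigr (fun=> 1)); last first.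
    by move=> w _; rewrite -expr2 sqrr_sign.
  by rewrite sumr_const.
pose flip w := [ffun k => w k (+) (k == i)].
have flipK : involutive flip.
  by move=> w; apply/ffunP => k; rewrite !ffunE -addbA addbb addbF.
rewrite mulr0; set s := \sum_(w : {ffun I -> bool}) _.
suff : s = - s by lra.
rewrite {1}/s (reindex_inj (inv_inj flipK)) /= -sumrN; apply: eq_bigr => w _.
by rewrite !ffunE eqxx eq_sym (negbTE ij) addbF addbT signrN mulNr.
Qed.

(** The first moment is compared with the second one, which is computed by
    orthogonality, through [|x| <= (x ^ 2 / m + m) / 2] at [m = sqrt #|A|]. *)
Lemma sign_sum_L1 A (c : I -> R) : (forall i, `|c i| <= 1) ->
  \sum_(w : {ffun I -> bool}) `|\sum_(i in A) c i * (-1) ^+ w i| <= N *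
    Num.sqrt #|A|%:R.
Proof.
move=> c1; have [->|[i0 Ai0]] := set_0Vmem A.
  by rewrite big1 ?mulr_ge0 ?sqrtr_ge0 ?(ltW N_gt0)// => w _;
    rewrite big_set0 normr0.
pose m := Num.sqrt (#|A|%:R : R).
have m0 : 0 < m by rewrite sqrtr_gt0 ltr0n; apply/card_gt0P; exists i0.
have m2 : m ^+ 2 = #|A|%:R by rewrite sqr_sqrtr.
have moment2 : \sum_(w : {ffun I -> bool}) (\sum_(i in A) c i * (-1) ^+ w i) ^+
  2 <= N * m ^+ 2.
  under eq_bigr => w _.
    rewrite expr2 mulr_suml; under eq_bigr => i _ do rewrite mulr_sumr.
    over.
  rewrite exchange_big /=; under eq_bigr => i _ do rewrite exchange_big /=.
  rewrite m2 mulr_natr -sumr_const; apply: ler_sum => i Ai.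
  rewrite (bigD1 i)//= [X in _ + X]big1 ?addr0 => [|j /andP[_ ji]].
    rewrite (eq_bigr (fun w => c i ^+ 2 * ((-1) ^+ w i * (-1) ^+ w i)));
      last first.
      by move=> w _; rewrite mulrACA.
    rewrite -mulr_sumr sign_orthogonality eqxx mulr1 ler_piMl ?(ltW N_gt0)//.
    by rewrite -real_normK ?num_real// exprn_ile1.
  rewrite (eq_bigr (fun w => c i * c j * ((-1) ^+ w i * (-1) ^+ w j)));
    last first.
    by move=> w _; rewrite mulrACA.
  by rewrite -mulr_sumr sign_orthogonality eq_sym (negbTE ji) !mulr0.
apply: (@le_trans _ _ (\sum_(w : {ffun I ->
  bool}) ((\sum_(i in A) c i * (-1) ^+ w i) ^+ 2 / m + m) / 2)).
  apply: ler_sum => w _; set x := \sum_(i in A) _.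
  rewrite ler_pdivlMr// -lerBlDr ler_pdivlMr//.
  have := sqr_ge0 (`|x| - m); rewrite -(real_normK (num_real x)); nra.
rewrite -mulr_suml big_split /= -mulr_suml sumr_const -[m *+ _]mulr_natl -/N.
rewrite ler_pdivrMr// -lerBrDr ler_pdivrMr//; apply: le_trans moment2 _.
by rewrite -/m; nra.
Qed.

(** Averaging over signs splits a diagonal sum into a product of a sum of
    functionals and a sum of vectors. *)
Lemma sign_decoupling {E : normedModType R} A (f : I -> 'L(E, R^o)) (y : I -> E)
    (T : 'L(E, E)) (C D : R) : 0 <= C ->
  (forall v, \sum_(i in A) `|f i v| <= C * `|v|) ->
  (forall w, `|\sum_(i in A) (-1) ^+ w i *: y i| <= D) ->
  `|\sum_(i in A) f i (T (y i))| <= C * `|T| * D.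
Proof.
move=> C0 fC yD; rewrite -(ler_pM2l N_gt0).
have -> : N * `|\sum_(i in A) f i (T (y i))| =
    `|\sum_(w : {ffun I -> bool}) \sum_(i in A) (-1) ^+ w i * f i (T (\sum_(j
      in A) (-1) ^+ w j *: y j))|.
  rewrite -[N in LHS]ger0_norm ?(ltW N_gt0)// -normrM; congr `|_|.
  rewrite mulr_sumr exchange_big /=; apply: eq_bigr => i Ai.
  under [RHS]eq_bigr => w _.
    rewrite (linear_sum T) (linear_sum (f i)) mulr_sumr /=.
    under eq_bigr => j _ do rewrite !opZ /= mulrA.
    over.
  rewrite exchange_big /= (bigD1 i)//= [X in _ + X]big1 ?addr0 =>
    [|j /andP[_ ji]].
    by rewrite -mulr_suml sign_orthogonality eqxx mulr1.
  by rewrite -mulr_suml sign_orthogonality eq_sym (negbTE ji) mulr0 mul0r.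
apply: le_trans (ler_norm_sum _ _ _) _.
rewrite mulr_natl -sumr_const; apply: ler_sum => w _.
apply: le_trans (ler_norm_sum _ _ _) _.
under eq_bigr => i _ do rewrite normrM normr_sign mul1r.
apply: le_trans (fC _) _; rewrite -mulrA ler_wpM2l//.
by apply: le_trans (le_op _ _) _; rewrite ler_wpM2l.
Qed.

End rademacher.

(** * Vectors that are Hilbertian on blocks and l1 across blocks *)

Section signed_means.
Context {R : realType} {X : normedModType R} (I : finType) (lab : I -> I).
Variable u : I * {ffun I -> bool} -> X.
Implicit Types (A : {set I}).

Let N : R := #|{ffun I -> bool}|%:R.

Let N_gt0 : 0 < N.
Proof. by rewrite ltr0n; apply/card_gt0P; exists [ffun=> true]. Qed.

(** The vectors [u (l, w)], [w] ranging over all choices of signs, play the role of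
    the unit vectors of an L1 space of signs attached to the label [l]; then
    [signed_mean i] is the [i]-th Rademacher function in the space of its label. *)
Definition signed_mean (i : I) : X :=
  N^-1 *: \sum_(w : {ffun I -> bool}) (-1) ^+ w i *: u (lab i, w).

(** Within one label the combination is a mean of the vectors [u (l, w)] with the
    sign sums of the coefficients as weights. *)
Lemma signed_mean_block A (c : I -> R) (l : I) : (forall p, `|u p| <= 1) ->
  (forall i, `|c i| <= 1) -> (forall i, i \in A -> lab i = l) ->
  `|\sum_(i in A) c i *: signed_mean i| <= Num.sqrt #|A|%:R.
Proof.
move=> u1 c1 Al.
have -> : \sum_(i in A) c i *: signed_mean i =
    N^-1 *: \sum_(w : {ffun I -> bool}) (\sum_(i in A) c i * (-1) ^+ w i) *: u
      (l, w).
  under [X in _ *: X]eq_bigr => w _ do rewrite scaler_suml.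
  rewrite exchange_big /= scaler_sumr; apply: eq_bigr => i Ai.
  rewrite scalerA mulrC -scalerA (Al _ Ai); congr (_ *: _).
  by rewrite scaler_sumr; apply: eq_bigr => w _; rewrite scalerA.
rewrite normrZ normfV gtr0_norm// ler_pdivrMl//.
apply: le_trans (sign_sum_L1 A c1); apply: le_trans (ler_norm_sum _ _ _) _.
by apply: ler_sum => w _; rewrite normrZ ler_piMr.
Qed.

(** A coefficient is recovered by pairing with its signs in the part of [b] that
    belongs to its label; different labels use disjoint parts of [b]. *)
Lemma signed_mean_coef (a : I -> R) :
  exists b : I * {ffun I -> bool} -> R,
    \sum_i a i *: signed_mean i = \sum_p b p *: u p /\
    forall A, {in A &, injective lab} -> \sum_(i in A) `|a i| <= \sum_p `|b p|.
Proof.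
pose b (p : I * {ffun I -> bool}) :=
  N^-1 * \sum_(i | lab i == p.1) (-1) ^+ p.2 i * a i.
exists b; split=> [|A labA].
  have -> : \sum_p b p *: u p =
      \sum_l \sum_(w : {ffun I -> bool}) b (l, w) *: u (l, w).
    by rewrite pair_bigA; apply: eq_bigr => -[].
  rewrite [RHS]exchange_big /=.
  transitivity (\sum_(w : {ffun I -> bool}) \sum_i (N^-1 * ((-1) ^+ w i * a i))
    *: u (lab i, w)).
    rewrite exchange_big /=; apply: eq_bigr => i _.
    rewrite scalerA scaler_sumr; apply: eq_bigr => w _.
    by rewrite scalerA; congr (_ *: _); ring.
  apply: eq_bigr => w _.
  rewrite (partition_big lab xpredT)//=; apply: eq_bigr => l _.
  rewrite /b mulr_sumr scaler_suml; apply: eq_bigr => i /eqP <-.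
  by [].
have aE i : a i = \sum_(w : {ffun I -> bool}) (-1) ^+ w i * b (lab i, w).
  transitivity (\sum_(w : {ffun I -> bool}) \sum_(j | lab j == lab i)
      N^-1 * a j * ((-1) ^+ w i * (-1) ^+ w j)); last first.
    apply: eq_bigr => w _; rewrite /b !mulr_sumr; apply: eq_bigr => j _ /=.
    by ring.
  rewrite exchange_big /= (bigD1 i)//= [X in _ + X]big1 ?addr0.
    rewrite -mulr_sumr sign_orthogonality eqxx mulr1 mulrAC mulVf ?mul1r//.
    by rewrite gt_eqF.
  move=> j /andP[_ ji]; rewrite -mulr_sumr sign_orthogonality eq_sym (negbTE ji).
  by rewrite !mulr0.
apply: (@le_trans _ _ (\sum_(i in A) \sum_(w : {ffun I ->
  bool}) `|b (lab i, w)|)).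
  apply: ler_sum => i _; rewrite {1}aE; apply: le_trans (ler_norm_sum _ _ _) _.
  by apply: ler_sum => w _; rewrite normrM normr_sign mul1r.
have -> : \sum_p `|b p| = \sum_l \sum_(w : {ffun I -> bool}) `|b (l, w)|.
  by rewrite pair_bigA; apply: eq_bigr => -[].
rewrite -(big_imset (fun l => \sum_(w : {ffun I ->
  bool}) `|b (l, w)|) labA) /= [leRHS](bigID (mem (lab @: A))) /=.
by rewrite lerDl sumr_ge0// => l _; rewrite sumr_ge0.
Qed.

End signed_means.

(** * Finite linear combinations and coordinate functionals *)

Section combinations.
Context {R : realType} {X : normedModType R} {I : eqType}.
Variable e : I -> X.
Implicit Types s : seq (R * I).

(** Formal linear combinations are lists of weighted indices, so that sums and
    multiples are lists again. *)
Definition comb s : X := \sum_(p <- s) p.1 *: e p.2.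

Definition coef s (k : I) : R := \sum_(p <- s) p.1 * (p.2 == k)%:R.

Definition scale_comb (c : R) s : seq (R * I) := [seq (c * p.1, p.2) | p <- s].

Lemma combD s1 s2 : comb (s1 ++ s2) = comb s1 + comb s2.
Proof. exact: big_cat. Qed.

Lemma combZ c s : comb (scale_comb c s) = c *: comb s.
Proof. by rewrite /comb big_map scaler_sumr; apply: eq_bigr => p _;
  rewrite scalerA. Qed.

Lemma coefD s1 s2 k : coef (s1 ++ s2) k = coef s1 k + coef s2 k.
Proof. exact: big_cat. Qed.

Lemma coefZ c s k : coef (scale_comb c s) k = c * coef s k.
Proof. by rewrite /coef big_map mulr_sumr; apply: eq_bigr => p _;
  rewrite mulrA. Qed.

End combinations.

Section coordinate_functionals.
Context {R : realType} {X : completeNormedModType R} {I : eqType}.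
Variables (e : I -> X) (Z : closed_subspace X) (C : R).
Hypotheses (C0 : 0 <= C)
  (Z_dense : forall (v : csub Z) (eps : R), 0 < eps ->
     exists s (v' : csub Z), csub_val v' = comb e s /\ `|v - v'| <= eps).

(** The closure [G] of the graph of the coordinate is the graph of a linear map,
    because the bound passes to limits. *)
Lemma extend_coordinate (k : I) :
  (forall s, `|coef s k| <= C * `|comb e s|) ->
  exists F : 'L(csub Z, R^o), forall s (v : csub Z),
    csub_val v = comb e s -> F v = coef s k.
Proof.
move=> kC.
pose G (v : csub Z) (r : R) := forall eps : R, 0 < eps -> exists s,
  `|csub_val v - comb e s| <= eps /\ `|r - coef s k| <= eps.
have GC v r : G v r -> `|r| <= C * `|v|.
  move=> Gvr; apply/ler_addgt0Pr => eps e0.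
  have C1 : 0 < C + 1 by rewrite ltr_wpDl.
  have [s [vs rs]] := Gvr _ (divr_gt0 e0 C1).
  have dE : eps / (C + 1) * (C + 1) = eps by rewrite divfK// gt_eqF.
  have rN : `|r| <= `|r - coef s k| + `|coef s k|.
    by rewrite -{1}[r](subrK (coef s k)) ler_normD.
  have sN : `|comb e s| <= `|csub_val v - comb e s| + `|csub_val v|.
    rewrite distrC -{1}[comb e s](subrK (csub_val v)); exact: ler_normD.
  have := ler_wpM2l C0 (le_trans sN (lerD vs (lexx _))).
  by have := kC s; rewrite -[`|v|]/(`|csub_val v|); lra.
have Glin c v w r t : G v r -> G w t -> G (c *: v + w) (c * r + t).
  move=> Gv Gw eps e0.
  have c1 : 0 < `|c| + 1 by rewrite ltr_wpDl.
  have d0 : 0 < eps / (`|c| + 1) by rewrite divr_gt0.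
  have de : `|c| * (eps / (`|c| + 1)) + eps / (`|c| + 1) = eps.
    by field; rewrite gt_eqF.
  have [s1 [v1 r1]] := Gv _ d0; have [s2 [v2 r2]] := Gw _ d0.
  exists (scale_comb c s1 ++ s2); rewrite combD combZ coefD coefZ; split.
    have -> : csub_val (c *: v + w) - (c *: comb e s1 + comb e s2) =
        c *: (csub_val v - comb e s1) + (csub_val w - comb e s2).
      by rewrite opprD addrACA scalerBr.
    apply: le_trans (ler_normD _ _) _; rewrite normrZ -[leRHS]de.
    by apply: lerD => //; rewrite ler_wpM2l.
  have -> : c * r + t - (c * coef s1 k + coef s2 k) =
      c * (r - coef s1 k) + (t - coef s2 k) by ring.
  apply: le_trans (ler_normD _ _) _; rewrite normrM -[leRHS]de.
  by apply: lerD => //; rewrite ler_wpM2l.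
have Guniq v r r' : G v r -> G v r' -> r = r'.
  move=> Gr Gr'; have := GC _ _ (Glin (-1) _ _ _ _ Gr Gr').
  rewrite scaleN1r addNr normr0 mulr0 normr_le0 mulN1r addrC subr_eq0.
  by move=> /eqP.
have /choice[F FP] (v : csub Z) : exists r : R, G v r.
  have /choice[s Hs] (n : nat) : exists s, `|csub_val v - comb e s| <= 2^-1 ^+ n.
    have [|s [v' [v's vv']]] := Z_dense v (_ : 0 < 2^-1 ^+ n).
      by rewrite exprn_gt0// invr_gt0.
    by exists s; rewrite -v's.
  have [n|r [_ Hr]] := @geometric_cvg R R^o (fun n => coef (s n) k) (2 * C).
    have -> : coef (s n.+1) k - coef (s n) k =
        coef (s n.+1 ++ scale_comb (-1) (s n)) k.
      by rewrite coefD coefZ mulN1r.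
    apply: le_trans (kC _) _; rewrite combD combZ scaleN1r -mulrA mulrCA
      ler_wpM2l//.
    rewrite -(subrKA (csub_val v)); apply: le_trans (ler_normD _ _) _.
    rewrite distrC; have := Hs n; have := Hs n.+1; rewrite exprS.
    have : 0 <= (2^-1 : R) ^+ n by rewrite exprn_ge0// invr_ge0.
    by set t := 2^-1 ^+ n; lra.
  exists r => eps e0; have [n Hn] := half_expn_small (4 * C + 1) e0.
  have t0 : 0 <= (2^-1 : R) ^+ n by rewrite exprn_ge0// invr_ge0.
  have Ct := mulr_ge0 C0 t0.
  exists (s n); split; [apply: le_trans (Hs n) _|rewrite distrC;
    apply: le_trans (Hr n) _].
    by lra.
  by lra.
have Flin : linear (F : csub Z -> R^o).
  by move=> c v w; apply: Guniq (FP _) _; apply: Glin.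
exists (BoundedOperator (bounded_linear_of_le Flin (fun v => GC _ _ (FP v)))).
move=> s v vs; apply: Guniq (FP v) _ => eps e0; exists s.
by rewrite vs !subrr !normr0 ltW.
Qed.

Lemma coordinate_block (J : finType) (A : {set J}) (f : J -> I)
    (F : I -> 'L(csub Z, R^o)) :
  (forall k s (v : csub Z), csub_val v = comb e s -> F k v = coef s k) ->
  (forall s, \sum_(j in A) `|coef s (f j)| <= C * `|comb e s|) ->
  forall v, \sum_(j in A) `|F (f j) v| <= C * `|v|.
Proof.
move=> FE AC v; apply/ler_addgt0Pr => eps e0.
pose B := \sum_(j in A) `|F (f j)|.
have B0 : 0 <= B by rewrite sumr_ge0.
have CB : 0 < C + B + 1 by rewrite ltr_wpDl// addr_ge0.
have [s [v' [v's vv']]] := Z_dense v (divr_gt0 e0 CB).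
have H1 : \sum_(j in A) `|F (f j) v'| <= C * `|v'|.
  have := AC s; rewrite -v's; apply: le_trans; apply: ler_sum => j _.
  by rewrite (FE _ s).
have H2 : \sum_(j in A) `|F (f j) (v - v')| <= B * `|v - v'|.
  by rewrite mulr_suml; apply: ler_sum => j _; exact: le_op.
have : \sum_(j in A) `|F (f j) v| <=
    \sum_(j in A) `|F (f j) (v - v')| + \sum_(j in A) `|F (f j) v'|.
  rewrite -big_split /=; apply: ler_sum => j _.
  by rewrite -{1}[v](subrK v') linearD ler_normD.
have v'N : `|v'| <= `|v - v'| + `|v|.
  by rewrite distrC -{1}[v'](subrK v) ler_normD.
have dE : eps / (C + B + 1) * (C + B + 1) = eps by rewrite divfK// gt_eqF.
have := ler_wpM2l C0 (le_trans v'N (lerD vv' (lexx _))).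
have := ler_wpM2l B0 vv'.
have : 0 <= eps / (C + B + 1) by rewrite divr_ge0// ltW.
by lra.
Qed.

End coordinate_functionals.

(** * The vectors indexed by bit strings *)

Section string_system.
Context {R : realType} {X : completeNormedModType R} (Y : closed_subspace X).
Variables (lab : seq bool -> seq bool).
Hypothesis lab_size : forall k, size (lab k) = size k.

Lemma lab_tupleP L (t : L.-tuple bool) : size (lab t) == L.
Proof. by rewrite lab_size size_tuple. Qed.

Let lab_tuple L (t : L.-tuple bool) : L.-tuple bool := Tuple (lab_tupleP t).

Let dim L : nat := #|{: L.-tuple bool * {ffun L.-tuple bool -> bool}}|.

Variables (u : nat -> nat -> X) (C : R).
Hypotheses (C0 : 0 <= C)
  (u_ball : forall L i, csub_set Y (u L i) /\ `|u L i| <= 1)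
  (u_l1 : forall M (c : nat -> nat -> R) n, (n < M)%N ->
      \sum_(0 <= i < dim n) `|c n i| <=
      C * `|\sum_(0 <= L < M) \sum_(0 <= i < dim L) c L i *: u L i|).

Let level L (t : L.-tuple bool) : X :=
  signed_mean (@lab_tuple L) (fun p => u L (enum_rank p)) t.

Let e (k : seq bool) : X := level (in_tuple k).

Let e_tuple L (t : L.-tuple bool) : e t = level t.
Proof.
case: t => k kL; rewrite /e /=; move/eqP: (kL) => E; subst L.
by congr level; apply: val_inj.
Qed.

Let csubY (I : Type) (r : seq I) (c : I -> R) (f : I -> X) :
  (forall i, csub_set Y (f i)) -> csub_set Y (\sum_(i <- r) c i *: f i).
Proof.
move=> Yf; have [Y0 YL] := csub_submod Y.
elim: r => [|i r IH]; first by rewrite big_nil; apply/set_mem; exact: Y0.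
rewrite big_cons; apply/set_mem; apply: YL; apply/mem_set => //.
Qed.

(** [block_l1_system] provides at each level as many vectors as there are pairs of a
    label and a choice of signs, which is what [signed_mean] asks for. *)
Lemma string_system : exists e : seq bool -> X,
  [/\ forall k, csub_set Y (e k),
      forall L (A : {set L.-tuple bool}) (c : L.-tuple bool -> R),
        (forall t, `|c t| <= 1) ->
        (forall t t', t \in A -> t' \in A -> lab t = lab t') ->
        `|\sum_(t in A) c t *: e t| <= Num.sqrt #|A|%:R &
      forall s L (A : {set L.-tuple bool}),
        (forall t t', t \in A -> t' \in A -> lab t = lab t' -> t = t') ->
        \sum_(t in A) `|coef s (tval t)| <= C * `|comb e s| ].
Proof.
exists e; split.
- move=> k; rewrite /e /level /signed_mean -[_ *: _]addr0.
  have [Y0 YL] := csub_submod Y; apply/set_mem; apply: YL => //.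
  by apply/mem_set/csubY => w; case: (u_ball (size k) (enum_rank (lab_tuple
    (in_tuple k), w))).
- move=> L A c c1 labA; under eq_bigr => t _ do rewrite e_tuple.
  have [->|[t0 At0]] := set_0Vmem A.
    by rewrite big_set0 normr0 sqrtr_ge0.
  apply: (signed_mean_block (l := lab_tuple t0)) => //.
    by move=> p; case: (u_ball L (enum_rank p)).
  by move=> t At; apply: val_inj; exact: labA.
move=> s L A labA.
(* A bound for [L] and for all the lengths that occur in [s]. *)
pose M := (L + \sum_(p <- s) (size p.2).+1).+1.
have sM p : p \in s -> (size p.2 < M)%N.
  by move=> ps; rewrite /M (big_rem p)//=; lia.
have combE : comb e s =
    \sum_(0 <= n < M) \sum_(t : n.-tuple bool) coef s t *: level t.
  have H p : p \in s -> e p.2 =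
      \sum_(0 <= n < M) \sum_(t : n.-tuple bool) (p.2 == t :> seq bool)%:R *:
        level t.
    move=> /sM pM.
    rewrite (bigD1_seq (size p.2)) ?mem_index_iota ?iota_uniq//=.
    rewrite [X in _ + X]big1 ?addr0 => [|n nL].
      rewrite (bigD1 (in_tuple p.2))//= eqxx scale1r [X in _ + X]big1 ?addr0//.
      by move=> t; rewrite -val_eqE /= eq_sym => /negbTE ->; rewrite scale0r.
    rewrite big1// => t _; rewrite (_ : _ == _ = false) ?scale0r//.
    by apply/negbTE; apply: contra nL => /eqP ->; rewrite size_tuple.
  rewrite /comb big_seq (eq_bigr _ (fun p ps => congr1 (fun x =>
    p.1 *: x) (H p ps))).
  rewrite -big_seq; under eq_bigr => p _ do rewrite scaler_sumr.
  rewrite exchange_big /=; apply: eq_bigr => n _.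
  under eq_bigr => p _ do rewrite scaler_sumr.
  rewrite exchange_big /=; apply: eq_bigr => t _.
  rewrite /coef scaler_suml; apply: eq_bigr => p _.
  by rewrite scalerA.
have Hb n := signed_mean_coef (@lab_tuple n)
  (fun p => u n (enum_rank p)) (fun t : n.-tuple bool => coef s (tval t)).
have /choice[b bP] (n : nat) : exists b : nat -> R,
    \sum_(t : n.-tuple bool) coef s t *: level t =
      \sum_(0 <= i < dim n) b i *: u n i /\
    forall A : {set n.-tuple bool}, {in A &, injective (@lab_tuple n)} ->
      \sum_(t in A) `|coef s t| <= \sum_(0 <= i < dim n) `|b i|.
  have [b [H1 H2]] := Hb n.
  pose P : finType := (n.-tuple bool * {ffun n.-tuple bool -> bool})%type.
  pose b' (i : nat) : R :=
    if (insub i : option 'I_(dim n)) is Some i' then b (@enum_val P P i') else 0.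
  have b'E (i : 'I_(dim n)) : b' i = b (@enum_val P P i) by rewrite /b' valK.
  exists b'; rewrite !big_mkord H1; split=> [|A' /H2 H].
    rewrite (reindex (@enum_val P P)) /=; last by apply/onW_bij/enum_val_bij.
    by apply: eq_bigr => i _; rewrite b'E enum_valK.
  apply: le_trans H _; rewrite (reindex (@enum_val P P)) /=;
    last by apply/onW_bij/enum_val_bij.
  by apply: ler_sum => i _; rewrite b'E.
have labtA : {in A &, injective (@lab_tuple L)}.
  by move=> t t' At At' /(congr1 val); exact: labA.
have H := (bP L).2 A labtA; apply: le_trans H _.
have LM : (L < M)%N by rewrite ltnS leq_addr.
apply: le_trans (u_l1 b LM) _; rewrite combE.
by rewrite (eq_bigr _ (fun n _ => (bP n).1)).
Qed.

End string_system.

(** * Bit strings *)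

(** The newest bit is the head; a position is counted from the last, oldest bit, so
    that it does not change when bits are added.  [keep P k] erases the bits at the
    positions outside [P]. *)
Fixpoint keep (P : pred nat) (k : seq bool) : seq bool :=
  if k is b :: k' then (b && P (size k')) :: keep P k' else [::].

Lemma size_keep P k : size (keep P k) = size k.
Proof. by elim: k => //= b k ->. Qed.

Lemma keep_sub (P P' : pred nat) k k' : (forall i, P' i -> P i) ->
  keep P k = keep P k' -> keep P' k = keep P' k'.
Proof.
move=> PP'; elim: k k' => [|b k IH] [|b' k'] //= [bb kk].
have sk : size k = size k' by rewrite -(size_keep P) kk size_keep.
rewrite (IH _ kk) -sk in bb *; congr (_ :: _).
by move: bb; case: (boolP (P' _)) => [/PP' ->|_]; rewrite ?andbF// !andbT.
Qed.

Lemma keep_inj (P : pred nat) k k' :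
  keep P k = keep P k' -> keep (predC P) k = keep (predC P) k' -> k = k'.
Proof.
elim: k k' => [|b k IH] [|b' k'] //= [bb kk] [cc ll].
have sk : size k = size k' by rewrite -(size_keep P) kk size_keep.
rewrite (IH _ kk ll); congr (_ :: _); move: bb cc; rewrite -sk.
by case: (P _); rewrite /= ?andbT ?andbF.
Qed.

Lemma big_tuple_cons {R : Type} {idx : R} {op : Monoid.com_law idx} n
    (G : seq bool -> R) :
  \big[op/idx]_(t : n.+1.-tuple bool) G t =
  \big[op/idx]_(b : bool) \big[op/idx]_(t : n.-tuple bool) G (b :: t).
Proof.
rewrite pair_bigA /= (reindex (fun p : bool * n.-tuple bool =>
  cons_tuple p.1 p.2)) //=.
exists (fun t : n.+1.-tuple bool => (thead t, [tuple of behead t])).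
  by move=> [b t] _ /=; congr pair; apply: val_inj.
by move=> t _; rewrite /= [RHS](tuple_eta t); apply: val_inj.
Qed.

Lemma card_keep (P : pred nat) N (k : seq bool) : size k = N ->
  #|[set t : N.-tuple bool | keep P t == keep P k]%SET| =
  (2 ^ count (predC P) (iota 0 N))%N.
Proof.
move=> <- {N}; elim: k => [|b k IH].
  rewrite (_ : [set t | _]%SET = [set: _]%SET);
    first by rewrite cardsT card_tuple card_bool.
  by apply/setP => t; rewrite !inE (tuple0 t).
have -> : count (predC P) (iota 0 (size (b :: k))) =
    (count (predC P) (iota 0 (size k)) + ~~ P (size k))%N.
  by rewrite [size (b :: k)]/= -addn1 iotaD count_cat /= addn0 add0n.
rewrite -sum1dep_card big_mkcond (big_tuple_cons _ (fun t =>
  if keep P t == keep P (b :: k) then 1 else 0)%N) big_bool.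
have sizet (t : (size k).-tuple bool) : size t = size k by rewrite size_tuple.
have inner c : \sum_(t : (size k).-tuple bool)
    (if (c && P (size t) :: keep P t) == (b && P (size k) :: keep P k) then 1
      else 0)%N =
    ((c && P (size k) == b && P (size k)) * 2 ^ count (predC P) (iota 0 (size
      k)))%N.
  rewrite -IH -sum1dep_card [in RHS]big_mkcond big_distrr /=.
  apply: eq_bigr => t _; rewrite sizet eqseq_cons.
  by case: (_ == _); case: (_ == _).
have := inner true; have := inner false => /= -> ->.
rewrite expnD -mulnDl mulnC; congr (_ * _)%N.
by case: (P _); rewrite /= ?andbT ?andbF//=; case: (b).
Qed.

(** The residue modulo 8 of the positions that a string of length [n + 3] with head
    bits [s], [d] uses as its label; it differs for the four choices of the head bits
    and for consecutive lengths. *)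
Definition residue (s d : bool) (n : nat) : nat := (4 * odd n + 2 * d + s)%N.

Definition in_residue (r : nat) : pred nat := fun i => (i %% 8 == r)%N.

Lemma residue_lt8 s d n : (residue s d n < 8)%N.
Proof. by rewrite /residue; case: (odd n); case: s; case: d. Qed.

Lemma residue_head s d s' d' n : residue s d n = residue s' d' n ->
  s = s' /\ d = d'.
Proof. by rewrite /residue; case: (odd n); case: s; case: d; case: s';
  case: d'. Qed.

Lemma residue_parity s d s' d' n n' : odd n != odd n' ->
  residue s d n <> residue s' d' n'.
Proof.
by rewrite /residue; case: (odd n); case: (odd n'); case: s; case: d; case: s';
  case: d'.
Qed.

(** The bit next to the two head bits is left out of the label: it is a head bit of
    the strings that are one bit shorter. *)
Definition label (k : seq bool) : seq bool :=
  if k is [:: s, d, b & q] then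
    [:: s, d, false & keep (in_residue (residue s d (size q))) q]
  else k.

Lemma size_label k : size (label k) = size k.
Proof. by case: k => [|s [|d [|b q]]] //=; rewrite size_keep. Qed.

Lemma count_residue r N : (r < 8)%N ->
  (N <= 8 * count (in_residue r) (iota 0 N) + 7)%N.
Proof.
move=> r8; suff -> : count (in_residue r) (iota 0 N) = ((N + 7 - r) %/ 8)%N.
  by lia.
elim: N => [|N IH]; first by rewrite /=; lia.
by rewrite -addn1 iotaD add0n count_cat IH /= /in_residue addn0; lia.
Qed.

(** Two strings in the same fibre differ only at the positions that the label of
    the strings [s :: d :: b :: q] sees. *)
Definition fibre (r : nat) (q : seq bool) : seq bool :=
  keep (predC (in_residue r)) q.

Lemma fibre_keep r r' q q' : r <> r' -> fibre r q = fibre r q' ->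
  keep (in_residue r') q = keep (in_residue r') q'.
Proof.
move=> rr'; apply: keep_sub => i /eqP ir /=; rewrite /in_residue ir.
by apply/eqP => /esym.
Qed.

Lemma fibre_size r q q' : fibre r q = fibre r q' -> size q = size q'.
Proof. by move=> qq'; rewrite -(size_keep (predC (in_residue r))) [keep _ _]qq'
  size_keep. Qed.

Lemma label_inj_fibre s d b q q' :
  fibre (residue s d (size q)) q = fibre (residue s d (size q)) q' ->
  label [:: s, d, b & q] = label [:: s, d, b & q'] -> q = q'.
Proof.
move=> qq' /= [H]; apply: (keep_inj _ qq').
by rewrite H (fibre_size qq').
Qed.

(** All the strings that occur with [s :: d :: b :: q] in the difference estimate,
    except this one, have a constant label on fibres: those of the same length here,
    the longer and the shorter ones in the next two lemmas. *)
Lemma label_fibre_same s d b s' d' q q' : (s', d') != (s, d) ->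
  fibre (residue s d (size q)) q = fibre (residue s d (size q)) q' ->
  label [:: s', d', b & q] = label [:: s', d', b & q'].
Proof.
move=> sd qq' /=; rewrite -(fibre_size qq'); congr [:: _, _, _ & _].
by apply: fibre_keep qq' => /residue_head [ss dd]; rewrite ss dd eqxx in sd.
Qed.

Lemma label_fibre_longer s d b s' d' d'' q q' :
  fibre (residue s d (size q)) q = fibre (residue s d (size q)) q' ->
  label [:: s', d', d'', b & q] = label [:: s', d', d'', b & q'].
Proof.
move=> qq' /=; rewrite -(fibre_size qq'); congr [:: _, _, _, _ & _].
by apply: fibre_keep qq'; apply: residue_parity => /=; case: (odd _).
Qed.

Lemma label_fibre_shorter s d b s' q q' :
  fibre (residue s d (size q)) q = fibre (residue s d (size q)) q' ->
  label [:: s', b & q] = label [:: s', b & q'].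
Proof.
case: q q' => [|c q] [|c' q'] //= qq'; have := fibre_size qq' => -[sq].
rewrite -sq; congr [:: _, _, _ & _].
case: qq' => _ qq'; apply: (fibre_keep _ qq').
by apply: residue_parity => /=; case: (odd _).
Qed.

(** * A closed subspace spanned by sums over three generations *)

Lemma closure_normP {R : realType} {X : normedModType R} (S : set X) x :
  closure S x <-> forall eps : R, 0 < eps -> exists2 y, S y & `|x - y| <= eps.
Proof.
split=> [Sx eps e0|H B /nbhs_ballP[eps /= e0 xB]].
  have [y [Sy]] := Sx _ (nbhsx_ballx x eps e0).
  by rewrite -ball_normE /= => /ltW; exists y.
have e20 : 0 < eps / 2 by rewrite divr_gt0.
have [y Sy xy] := H _ e20; exists y; split => //; apply: xB.
by rewrite -ball_normE /=; apply: le_lt_trans xy _; lra.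
Qed.

Lemma closed_span {R : realType} {X : completeNormedModType R} {I : eqType}
    (z : I -> X) : exists Z : closed_subspace X,
  [/\ forall i, csub_set Z (z i),
      forall (v : csub Z) (eps : R), 0 < eps -> exists s (v' : csub Z),
        csub_val v' = comb z s /\ `|v - v'| <= eps &
      forall Y : closed_subspace X, (forall i, csub_set Y (z i)) -> Z `<=` Y].
Proof.
pose S : set X := [set x | exists s, x = comb z s].
have Ssub : submod_closed (mem (closure S)).
  split.
    by apply/mem_set/subset_closure; exists [::]; rewrite /comb big_nil.
  move=> c x y /set_mem/closure_normP Sx /set_mem/closure_normP Sy.
  apply/mem_set/closure_normP => eps e0.
  have c1 : 0 < `|c| + 1 by rewrite ltr_wpDl.
  have d0 : 0 < eps / (`|c| + 1) by rewrite divr_gt0.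
  have [_ [s ->] xs] := Sx _ d0; have [_ [t ->] yt] := Sy _ d0.
  exists (comb z (scale_comb c s ++ t)); first by exists (scale_comb c s ++ t).
  rewrite combD combZ opprD addrACA -scalerBr; apply: le_trans (ler_normD _ _) _.
  rewrite normrZ; have -> : eps = `|c| * (eps / (`|c| + 1)) + eps / (`|c| + 1).
    by field; rewrite gt_eqF.
  by apply: lerD => //; rewrite ler_wpM2l.
pose Z := ClosedSubspace Ssub (@closed_closure _ S).
exists Z; split=> [i|v eps e0|Y Yz x /closure_normP Sx].
- by apply: subset_closure; exists [:: (1, i)]; rewrite /comb big_seq1 scale1r.
- have /set_mem/closure_normP/(_ _ e0)[_ [s ->] vs] : csub_val v \in in_csub Z.
    by case: v.
  have Zs : comb z s \in in_csub Z by apply/mem_set/subset_closure; exists s.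
  by exists s, (Csub Zs).
have -> : csub_set Y = closure (csub_set Y) by apply/closure_id/csub_closed.
apply/closure_normP => eps e0; have [_ [s ->] xs] := Sx _ e0;
  exists (comb z s) => //.
have [Y0 YL] := csub_submod Y.
rewrite /comb; elim: s {xs} => [|p s IH]; first by rewrite big_nil; exact/set_mem.
by rewrite big_cons; apply/set_mem/YL; exact/mem_set.
Qed.

Lemma regroup_difference (V : zmodType) (p q c m g : V) :
  p + q - (c + (m + g)) = (p - m) + q - c - g.
Proof. by rewrite !opprD (AC (2*(1*2)) ((((1*4)*2)*3)*5)). Qed.

(** [8 * c >= N - 7] means that a fibre of strings of length [N] has at least
    [2 ^ (N / 8 - 1)] elements; the constant [31 / 32] has sixteenth power at least
    one half. *)
Lemma geometric_fibre_bound {R : realType} (N c : nat) : (N <= 8 * c + 7)%N ->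
  (Num.sqrt (2 ^ c)%:R)^-1 <= (31 / 32 : R) ^+ (N - 7).
Proof.
move=> Nc; have r0 : 0 <= 31 / 32 :> R by lra.
have r1 : 31 / 32 <= 1 :> R by lra.
have r16 : 2^-1 <= (31 / 32) ^+ 16 :> R.
  have r2 : 15 / 16 <= (31 / 32) ^+ 2 :> R by lra.
  have r4 : 7 / 8 <= (31 / 32) ^+ 4 :> R by rewrite (exprM _ 2 2); nra.
  have r8 : 3 / 4 <= (31 / 32) ^+ 8 :> R by rewrite (exprM _ 4 2); nra.
  by rewrite (exprM _ 8 2); nra.
apply: (@le_trans _ _ ((31 / 32) ^+ (8 * c))); last first.
  by apply: ler_wiXn2l => //; lia.
rewrite -(ler_pXn2r (_ : 0 < 2)%N) ?nnegrE ?invr_ge0 ?sqrtr_ge0 ?exprn_ge0//.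
rewrite exprVn sqr_sqrtr ?ler0n// -exprM mulnAC (exprM _ (8 * 2)) natrX -exprVn.
by apply: lerXn2r; rewrite ?nnegrE ?invr_ge0 ?exprn_ge0.
Qed.

Section three_generations.
Context {R : realType} {X : completeNormedModType R}.
Variables (e : seq bool -> X) (C : R).
Hypotheses (C0 : 0 <= C)
  (e_block : forall L (A : {set L.-tuple bool}) (c : L.-tuple bool -> R),
     (forall t, `|c t| <= 1) ->
     (forall t t', t \in A -> t' \in A -> label t = label t') ->
     `|\sum_(t in A) c t *: e t| <= Num.sqrt #|A|%:R)
  (e_coef : forall s L (A : {set L.-tuple bool}),
     (forall t t', t \in A -> t' \in A -> label t = label t' -> t = t') ->
     \sum_(t in A) `|coef s (tval t)| <= C * `|comb e s|).

Lemma block_sum (J : finType) (A : {set J}) (f : J -> seq bool) n (c : J -> R) :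
  (forall j, size (f j) = n) -> {in A &, injective f} ->
  {in A &, forall i j, label (f i) = label (f j)} -> (forall j, `|c j| <= 1) ->
  `|\sum_(j in A) c j *: e (f j)| <= Num.sqrt #|A|%:R.
Proof.
move=> fn finj flab c1.
have fnP j : size (f j) == n by apply/eqP.
pose g j : n.-tuple bool := Tuple (fnP j).
have ginj : {in A &, injective g} by move=> i j Ai Aj /(congr1 val); exact: finj.
pose c' (t : n.-tuple bool) := if [pick j in A | g j == t] is Some j then c j
  else 0.
have c'E j : j \in A -> c' (g j) = c j.
  move=> Aj; rewrite /c'; case: pickP => [i /andP[Ai /eqP gij]|/(_ j)].
    by rewrite (ginj i j).
  by rewrite Aj eqxx.
have -> : \sum_(j in A) c j *: e (f j) = \sum_(t in g @: A) c' t *: e t.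
  rewrite (big_imset (fun t : n.-tuple bool => c' t *: e t))//=.
  by apply: eq_bigr => j Aj; rewrite c'E.
rewrite -(card_in_imset ginj); apply: e_block =>
  [t|_ _ /imsetP[i Ai ->] /imsetP[j Aj ->]].
  by rewrite /c'; case: pickP => // _; rewrite normr0.
exact: flab.
Qed.

Lemma coef_sum s (J : finType) (A : {set J}) (f : J -> seq bool) n :
  (forall j, size (f j) = n) ->
  {in A &, forall i j, label (f i) = label (f j) -> i = j} ->
  \sum_(j in A) `|coef s (f j)| <= C * `|comb e s|.
Proof.
move=> fn flab.
have fnP j : size (f j) == n by apply/eqP.
pose g j : n.-tuple bool := Tuple (fnP j).
have ginj : {in A &, injective g}.
  by move=> i j Ai Aj /(congr1 val) /= gij; apply: flab => //; rewrite gij.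
have -> : \sum_(j in A) `|coef s (f j)| = \sum_(t in g @: A) `|coef s (tval t)|.
  by rewrite (big_imset (fun t : n.-tuple bool => `|coef s (tval t)|)).
apply: e_coef => _ _ /imsetP[i Ai ->] /imsetP[j Aj ->] /= H.
by rewrite (flab i j).
Qed.

Lemma norm_e k : `|e k| <= 1.
Proof.
have := @block_sum unit [set: unit]%SET (fun=> k) (size k) (fun=> 1) (fun=>
  erefl).
rewrite big_const cardsT card_unit /= scale1r addr0 sqrtr1; apply=> //.
  by move=> [] [].
by move=> _; rewrite normr1.
Qed.

(** Both half the difference of the coordinates at the two children of [w] and the
    mean of the coordinates at its four grandchildren read off the coefficient of
    [z w] in a combination of these vectors. *)
Definition zcomb (w : seq bool) : seq (R * seq bool) :=
  [:: (1, false :: w); (-1, true :: w);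
      (1, [:: false, false & w]); (1, [:: true, false & w]);
      (1, [:: false, true & w]); (1, [:: true, true & w])].

Definition z (w : seq bool) : X := comb e (zcomb w).

Lemma zE w : z w = e (false :: w) - e (true :: w) +
  \sum_(d : bool) \sum_(s : bool) e [:: s, d & w].
Proof.
rewrite /z /comb !big_cons big_nil /= !scale1r scaleN1r addr0 !big_bool /=.
rewrite -[RHS]addrA; congr (_ + (_ + _)).
by rewrite [RHS](AC (2*2) (4*(3*(2*1)))).
Qed.

Variables (Z : closed_subspace X) (zz : seq bool -> csub Z)
  (F : seq bool -> 'L(csub Z, R^o)).
Hypotheses (zzE : forall w, csub_val (zz w) = z w)
  (Z_dense : forall (v : csub Z) (eps : R), 0 < eps -> exists s (v' : csub Z),
     csub_val v' = comb z s /\ `|v - v'| <= eps)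
  (FE : forall k s (v : csub Z), csub_val v = comb e s -> F k v = coef s k)
  (F_sum : forall (J : finType) (A : {set J}) (f : J -> seq bool) n,
     (forall j, size (f j) = n) ->
     {in A &, forall i j, label (f i) = label (f j) -> i = j} ->
     forall v, \sum_(j in A) `|F (f j) v| <= C * `|v|).

Lemma op_comb (G : normedModType R) (D : 'L(csub Z, G)) s (v : csub Z) :
  csub_val v = comb z s -> D v = \sum_(p <- s) p.1 *: D (zz p.2).
Proof.
move=> vs; have -> : v = \sum_(p <- s) p.1 *: zz p.2.
  apply: val_inj => /=; rewrite vs /comb.
  have := linear_sum (csub_incl Z) s xpredT (fun p => p.1 *: zz p.2).
  by move=> /= ->; apply: eq_bigr => p _; rewrite -zzE.
by rewrite linear_sum; apply: eq_bigr => p _; rewrite /= opZ.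
Qed.

Lemma op_eq_on_z (G : normedModType R) (D D' : 'L(csub Z, G)) :
  (forall w, D (zz w) = D' (zz w)) -> D = D'.
Proof.
move=> DD'; apply/eqP; rewrite -subr_eq0; apply/eqP.
apply: opP => v; apply/eqP; rewrite -normr_le0; apply/ler_addgt0Pr => eps e0.
set E := D - D'; have E1 : 0 < `|E| + 1 by rewrite ltr_wpDl.
have [s [v' [v's vv']]] := Z_dense v (divr_gt0 e0 E1).
have Ev' : E v' = 0.
  rewrite (op_comb _ v's) big1// => p _.
  by rewrite -[E _]/(D (zz p.2) - D' (zz p.2)) DD' subrr scaler0.
have -> : E v = E (v - v') by rewrite opB Ev' subr0.
apply: le_trans (le_op _ _) _; rewrite add0r.
move: vv'; rewrite ler_pdivlMr//; have := normr_ge0 (v - v').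
by have := normr_ge0 E; nra.
Qed.

Lemma F_zz k w : F k (zz w) =
  (k == false :: w)%:R - (k == true :: w)%:R +
  \sum_(d : bool) \sum_(s : bool) (k == [:: s, d & w])%:R.
Proof.
rewrite (FE k (zzE w)) /coef /zcomb !big_cons big_nil /= !big_bool /=.
by rewrite !(eq_sym _ k); ring.
Qed.

Definition zcoord w : 'L(csub Z, R^o) :=
  2^-1 *: (F (false :: w) - F (true :: w)).

Lemma zcoord_zz w w' : zcoord w (zz w') = (w == w')%:R.
Proof.
rewrite -[LHS]/(2^-1 * (F (false :: w) (zz w') - F (true :: w) (zz w'))).
rewrite !F_zz !big_bool /= !eqseq_cons /=.
by case: (w == w') => /=; lra.
Qed.

(** This second formula compares strings of length [n] with those of length
    [n + 1]: the functionals on the right are those in the coordinates of the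
    [z (d :: w)]. *)
Lemma zcoord_mean w :
  zcoord w = 4^-1 *: \sum_(d : bool) \sum_(s : bool) F [:: s, d & w].
Proof.
apply: op_eq_on_z => w'; rewrite zcoord_zz.
have -> : (4^-1 *: (\sum_(d : bool) \sum_(s : bool) F [:: s, d & w])) (zz w') =
    4^-1 * \sum_(d : bool) \sum_(s : bool) F [:: s, d & w] (zz w').
  rewrite -[LHS]/(4^-1 *: ((\sum_(d : bool) \sum_(s : bool) F [:: s,
    d & w]) (zz w'))).
  by rewrite op_sumE; congr (_ * _); apply: eq_bigr => d _; rewrite op_sumE.
rewrite !big_bool !F_zz !big_bool /= !eqseq_cons /=.
case: w => [|b w] /=; case: w' => [|b' w'] /=; rewrite ?eqseq_cons /=; lra.
Qed.

(** An approximate normalised trace. *)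
Definition trace_mean n (T : 'L(csub Z, csub Z)) : R :=
  2^-1 ^+ n * \sum_(w : n.-tuple bool) zcoord w (T (zz w)).

(** The vector paired with the coordinate at [s :: d :: p] in the difference of
    consecutive means.  Its own coefficient at [s :: d :: p] is zero. *)
Definition difference_vector (s d : bool) (p : seq bool) : csub Z :=
  (-1) ^+ s *: zz (d :: p) - zz p.

(** The coordinates of the longer strings are differences, those of the shorter
    ones are means, over the same coordinate functionals. *)
Lemma trace_mean_succ n T : trace_mean n.+1 T - trace_mean n T =
  2^-1 ^+ n.+2 * \sum_(s : bool) \sum_(d : bool) \sum_(p : n.-tuple bool)
    F [:: s, d & p] (T (difference_vector s d p)).
Proof.
rewrite /trace_mean (big_tuple_cons n (fun k => zcoord k (T (zz k)))).
have -> : \sum_(d : bool) \sum_(p : n.-tuple bool) zcoord (d :: p) (T (zz (d ::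
  p))) =
    2^-1 * \sum_(s : bool) \sum_(d : bool) \sum_(p : n.-tuple bool)
      (-1) ^+ s * F [:: s, d & p] (T (zz (d :: p))).
  rewrite [X in _ * X]exchange_big mulr_sumr; apply: eq_bigr => d _.
  rewrite exchange_big mulr_sumr; apply: eq_bigr => p _.
  rewrite big_bool /= expr1 expr0 mulN1r mul1r addrC.
  by [].
have -> : \sum_(p : n.-tuple bool) zcoord p (T (zz p)) =
    4^-1 * \sum_(s : bool) \sum_(d : bool) \sum_(p : n.-tuple bool)
      F [:: s, d & p] (T (zz p)).
  rewrite [X in _ * X]exchange_big; under [X in _ * X]eq_bigr =>
    d _ do rewrite exchange_big.
  rewrite [X in _ * X]exchange_big mulr_sumr; apply: eq_bigr => p _.
  rewrite zcoord_mean.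
  rewrite -[LHS]/(4^-1 * ((\sum_(d : bool) \sum_(s : bool) F [:: s,
    d & p]) (T (zz p)))).
  by rewrite op_sumE; congr (_ * _); apply: eq_bigr => d _; rewrite op_sumE.
rewrite !mulrA (_ : 2^-1 ^+ n.+1 * 2^-1 = 2^-1 ^+ n.+2 :> R);
  last by rewrite -exprSr.
rewrite (_ : 2^-1 ^+ n * 4^-1 = 2^-1 ^+ n.+2 :> R); last by rewrite !exprS; field.
rewrite -mulrBr; congr (_ * _); rewrite -sumrB; apply: eq_bigr => s _.
rewrite -sumrB; apply: eq_bigr => d _; rewrite -sumrB; apply: eq_bigr => p _.
by rewrite /difference_vector !opB !opZ.
Qed.

Section fibre.
Variables (s d b : bool) (N : nat) (A : {set N.-tuple bool}).
Hypothesis A_fibre : {in A &, forall q q',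
  fibre (residue s d N) (tval q) = fibre (residue s d N) (tval q')}.

Lemma fibre_block_sum (pi : seq bool) (c : N.-tuple bool -> R) :
  (forall q, `|c q| <= 1) ->
  {in A &, forall q q', label (pi ++ tval q) = label (pi ++ tval q')} ->
  `|\sum_(q in A) c q *: e (pi ++ q)| <= Num.sqrt #|A|%:R.
Proof.
move=> c1 labA; apply: (@block_sum _ A (fun q => pi ++ q) (size pi + N)) => //.
  by move=> q; rewrite size_cat size_tuple.
move=> q q' _ _ /eqP; rewrite eqseq_cat// eqxx => /eqP H.
exact: val_inj.
Qed.

(** Apart from the cancelled term, the difference vectors involve nine families of
    vectors [e], each with a constant label on the fibre; the coefficients have
    absolute values adding up to ten. *)
Lemma difference_vector_sum (w : {ffun N.-tuple bool -> bool}) :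
  `|\sum_(q in A) (-1) ^+ w q *: difference_vector s d (b :: q)| <=
    10 * Num.sqrt #|A|%:R.
Proof.
set rho := Num.sqrt _.
pose B (pi : seq bool) := \sum_(q in A) (-1) ^+ w q *: e (pi ++ q).
have sgn1 q : `|(-1) ^+ w q| <= 1 :> R by rewrite normr_sign.
have AF q q' : q \in A -> q' \in A ->
    fibre (residue s d (size q)) (tval q) = fibre (residue s d (size q)) (tval
      q').
  by move=> Aq Aq'; rewrite size_tuple; exact: A_fibre.
have B_same s' d' : (s', d') != (s, d) -> `|B [:: s'; d'; b]| <= rho.
  move=> sd; apply: fibre_block_sum => // q q' Aq Aq'.
  by apply: label_fibre_same sd _; exact: AF.
have B_long s' d' : `|B [:: s'; d'; d; b]| <= rho.
  apply: fibre_block_sum => // q q' Aq Aq'.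
  by apply: (label_fibre_longer (s := s) (d := d)); exact: AF.
have B_short s' : `|B [:: s'; b]| <= rho.
  apply: fibre_block_sum => // q q' Aq Aq'.
  by apply: (label_fibre_shorter (s := s) (d := d)); exact: AF.
have zsum pi : \sum_(q in A) (-1) ^+ w q *: z (pi ++ q) =
    B (false :: pi) - B (true :: pi) +
    \sum_(d' : bool) \sum_(s' : bool) B [:: s', d' & pi].
  under eq_bigr => q _ do rewrite zE scalerDr scalerBr scaler_sumr.
  rewrite big_split sumrB /=; congr (_ + _).
  rewrite exchange_big; apply: eq_bigr => d' _.
  under eq_bigr => q _ do rewrite scaler_sumr.
  by rewrite exchange_big.
rewrite -[leLHS]/(`|csub_incl Z _|) linear_sum /=.
have -> : \sum_(q in A) csub_val ((-1) ^+ w q *: difference_vector s d (b :: q)) =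
    (-1) ^+ s *: (\sum_(q in A) (-1) ^+ w q *: z ([:: d; b] ++ q)) -
    \sum_(q in A) (-1) ^+ w q *: z ([:: b] ++ q).
  rewrite scaler_sumr -sumrB; apply: eq_bigr => q _.
  rewrite -!zzE scalerA [_ ^+ s * _]mulrC -scalerA -scalerBr.
  by [].
rewrite !zsum.
have -> : \sum_(d' : bool) \sum_(s' : bool) B [:: s', d' & [:: b]] =
    (B [:: false; d; b] + B [:: true; d; b]) +
    (B [:: false; ~~ d; b] + B [:: true; ~~ d; b]).
  by rewrite !big_bool /= ![B [:: true; _; _] + _]addrC; case: (d) => //=;
    rewrite addrC.
rewrite scalerDr regroup_difference.
have -> : (-1) ^+ s *: (B [:: false; d; b] - B [:: true; d; b]) -
     (B [:: false; d; b] + B [:: true; d; b]) = - 2 *: B [:: ~~ s; d; b].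
  case: (s) => /=.
    rewrite expr1 scaleN1r opprB opprD (AC (2*2) ((1*4)*(2*3))) /= subrr add0r.
    by rewrite scaleNr scaler_nat mulr2n opprD.
  rewrite expr0 scale1r opprD (AC (2*2) ((1*3)*(2*4))) /= subrr add0r.
  by rewrite scaleNr scaler_nat mulr2n opprD.
have -> : 10 * rho = 2 * rho + 4 * rho + 2 * rho + 2 * rho by ring.
have sd : (~~ s, d) != (s, d) by rewrite xpair_eqE; case: (s).
have ds s' : (s', ~~ d) != (s, d) by rewrite xpair_eqE andbC; case: (d).
apply: le_trans (ler_normB _ _) _; apply: lerD; last first.
  by apply: le_trans (ler_normD _ _) _; have := B_same _ _ (ds true);
     have := B_same _ _ (ds false); lra.
apply: le_trans (ler_normB _ _) _; apply: lerD; last first.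
  by apply: le_trans (ler_normB _ _) _; have := B_short true;
     have := B_short false; lra.
apply: le_trans (ler_normD _ _) _; apply: lerD.
  rewrite normrZ normrN ger0_norm//; by have := B_same _ _ sd; lra.
rewrite normrZ normr_sign mul1r !big_bool /=.
apply: le_trans (ler_normD _ _) _.
have H s' d' := B_long s' d'.
have := ler_normD (B [:: true; true; d; b]) (B [:: false; true; d; b]).
have := ler_normD (B [:: true; false; d; b]) (B [:: false; false; d; b]).
by have := H true true; have := H true false; have := H false true;
   have := H false false; lra.
Qed.

Lemma fibre_trace (T : 'L(csub Z, csub Z)) :
  `|\sum_(q in A) F [:: s, d, b & q] (T (difference_vector s d (b :: q)))| <=
    C * `|T| * (10 * Num.sqrt #|A|%:R).
Proof.
apply: (@sign_decoupling _ _ _ A (fun q => F [:: s, d, b & tval q])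
  (fun q => difference_vector s d (b :: q))) => //.
  apply: (F_sum (n := N.+3)); first by move=> q; rewrite /= size_tuple.
  move=> q q' Aq Aq' H; apply: val_inj; apply: label_inj_fibre H.
  by rewrite size_tuple; exact: A_fibre.
exact: difference_vector_sum.
Qed.

End fibre.

(** The strings are partitioned into fibres of equal size; the gain is the inverse
    square root of that size. *)
Lemma level_trace s d b N (T : 'L(csub Z, csub Z)) :
  `|\sum_(q : N.-tuple bool) F [:: s, d, b & q]
       (T (difference_vector s d (b :: q)))| <=
    10 * C * `|T| * 2 ^+ N * (31 / 32) ^+ (N - 7).
Proof.
pose r := residue s d N.
have keyP (q : N.-tuple bool) : size (fibre r q) == N.
  by rewrite /fibre size_keep size_tuple.
pose key (q : N.-tuple bool) : N.-tuple bool := Tuple (keyP q).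
pose A (c : N.-tuple bool) := [set q | key q == c]%SET.
have A_fibre c : {in A c &, forall q q', fibre r (tval q) = fibre r (tval q')}.
  by move=> q q'; rewrite !inE => /eqP <- /eqP /(congr1 val) /= ->.
pose m := count (in_residue r) (iota 0 N).
have cardA c : Num.sqrt #|A c|%:R <= #|A c|%:R * (31 / 32) ^+ (N - 7) :> R.
  have [->|[q Aq]] := set_0Vmem (A c).
    by rewrite cards0 sqrtr0 mul0r.
  have -> : #|A c| = (2 ^ m)%N.
    have -> : A c = [set t : N.-tuple bool |
        keep (predC (in_residue r)) t == keep (predC (in_residue r)) q]%SET.
      by apply/setP => t; move: Aq; rewrite !inE => /eqP <-.
    rewrite card_keep ?size_tuple//; congr (2 ^ _)%N; apply: eq_count => i /=.
    by rewrite negbK.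
  have := geometric_fibre_bound (R := R) (count_residue N (residue_lt8 s d N)).
  rewrite -/r -/m.
  set x := Num.sqrt _; have x0 : 0 < x by rewrite sqrtr_gt0 ltr0n expn_gt0.
  have -> : (2 ^ m)%:R = x * x by rewrite -expr2 sqr_sqrtr.
  move=> /(ler_wpM2l (ltW x0)); rewrite mulfV ?gt_eqF// => xu.
  by rewrite -mulrA ler_peMr// ltW.
rewrite (partition_big key xpredT)//=.
apply: le_trans (ler_norm_sum _ _ _) _.
apply: (@le_trans _ _ (\sum_(c : N.-tuple bool)
    C * `|T| * (10 * (#|A c|%:R * (31 / 32) ^+ (N - 7))))).
  apply: ler_sum => c _.
  rewrite (eq_bigl (fun q => q \in A c)) => [|q]; last by rewrite inE.
  apply: le_trans (fibre_trace b (A_fibre c) T) _.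
  by rewrite ler_wpM2l ?mulr_ge0// ler_wpM2l.
rewrite -!mulr_sumr -mulr_suml -natr_sum.
have -> : (\sum_(c : N.-tuple bool) #|A c|)%N = (2 ^ N)%N.
  under eq_bigr => c _ do rewrite -sum1dep_card.
  transitivity (\sum_(q : N.-tuple bool) 1)%N.
    by rewrite [RHS](partition_big key xpredT).
  by rewrite sum1_card card_tuple card_bool.
by rewrite natrX le_eqVlt; apply/orP; left; apply/eqP; ring.
Qed.

Lemma trace_mean_diff N (T : 'L(csub Z, csub Z)) :
  `|trace_mean N.+2 T - trace_mean N.+1 T| <= 10 * C * `|T| * (31 / 32) ^+ (N -
    7).
Proof.
rewrite trace_mean_succ normrM ger0_norm ?exprn_ge0 ?invr_ge0//.
set u := (31 / 32) ^+ (N - 7).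
have H s d : `|\sum_(p : N.+1.-tuple bool) F [:: s,
  d & p] (T (difference_vector s d p))|
    <= 2 * (10 * C * `|T| * 2 ^+ N * u).
  rewrite (big_tuple_cons N (fun p => F [:: s,
    d & p] (T (difference_vector s d p)))).
  rewrite big_bool; apply: le_trans (ler_normD _ _) _.
  have := level_trace s d true N T; have := level_trace s d false N T.
  by rewrite -/u; lra.
have sum : `|\sum_(s : bool) \sum_(d : bool) \sum_(p : N.+1.-tuple bool)
    F [:: s, d & p] (T (difference_vector s d p))| <= 8 * (10 * C * `|T| * 2 ^+
      N * u).
  rewrite !big_bool /=; apply: le_trans (ler_normD _ _) _.
  apply: (@le_trans _ _ (4 * (10 * C * `|T| * 2 ^+ N * u) + 4 * (10 * C * `|T|
    * 2 ^+ N * u))).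
    apply: lerD; apply: le_trans (ler_normD _ _) _.
      by have := H true true; have := H true false; lra.
    by have := H false true; have := H false false; lra.
  by lra.
apply: le_trans (ler_wpM2l _ sum) _; first by rewrite exprn_ge0// invr_ge0.
rewrite le_eqVlt; apply/orP; left; apply/eqP.
have : 2^-1 ^+ N * 2 ^+ N = 1 :> R by rewrite -exprMn mulVf ?expr1n// pnatr_eq0.
rewrite !exprS; set x := 2^-1 ^+ N; set y := 2 ^+ N => xy.
have -> : 10 * C * `|T| * u = 10 * C * `|T| * u * (x * y) by rewrite xy mulr1.
by field.
Qed.

Lemma zcoord_le w v : `|zcoord w v| <= C * `|v|.
Proof.
have FC k : `|F k v| <= C * `|v|.
  have H : {in [set: unit]%SET &, forall i j, label k = label k -> i = j}.
    by move=> [] [].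
  have := @F_sum unit [set: unit]%SET (fun=> k) (size k) (fun=> erefl) H v.
  by rewrite big_const cardsT card_unit /= addr0.
rewrite -[X in `|X|]/(2^-1 * (F (false :: w) v - F (true :: w) v)).
rewrite normrM ger0_norm ?invr_ge0//.
have := ler_normB (F (false :: w) v) (F (true :: w) v).
by have := FC (false :: w); have := FC (true :: w); lra.
Qed.

Lemma norm_zz w : `|zz w| <= 6.
Proof.
rewrite -[`|_|]/(`|csub_val (zz w)|) zzE zE !big_bool /=.
have n k := norm_e k.
apply: le_trans (ler_normD _ _) _; apply: (@le_trans _ _ (2 + 4)); last by lra.
apply: lerD.
  apply: le_trans (ler_normB _ _) _.
  by have := n (false :: w); have := n (true :: w); lra.
apply: le_trans (ler_normD _ _) _.
have := ler_normD (e [:: true, true & w]) (e [:: false, true & w]).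
have := ler_normD (e [:: true, false & w]) (e [:: false, false & w]).
have := n [:: true, true & w]; have := n [:: false, true & w].
by have := n [:: true, false & w]; have := n [:: false, false & w]; lra.
Qed.

Lemma trace_meanB n T T' : trace_mean n (T - T') = trace_mean n T - trace_mean
  n T'.
Proof.
rewrite /trace_mean -mulrBr -sumrB; congr (_ * _); apply: eq_bigr => w _.
by rewrite -opB.
Qed.

Lemma trace_mean_le n (T : 'L(csub Z, csub Z)) (c : R) :
  (forall w, size w = n -> `|zcoord w (T (zz w))| <= c) -> `|trace_mean n T| <= c.
Proof.
move=> H; rewrite /trace_mean normrM ger0_norm ?exprn_ge0 ?invr_ge0//.
rewrite exprVn ler_pdivrMl ?exprn_gt0//.
apply: le_trans (ler_norm_sum _ _ _) _.
apply: (@le_trans _ _ (\sum_(w : n.-tuple bool) c)).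
  by apply: ler_sum => w _; apply: H; rewrite size_tuple.
by rewrite sumr_const card_tuple card_bool -[leLHS]mulr_natl natrX.
Qed.

Lemma trace_mean_id n : trace_mean n (idop (csub Z)) = 1.
Proof.
rewrite /trace_mean (eq_bigr (fun=> 1)); last first.
  by move=> w _; rewrite -[LHS]/(zcoord w (zz w)) zcoord_zz eqxx.
by rewrite sumr_const card_tuple card_bool natrX -exprMn mulVf ?expr1n//
  pnatr_eq0.
Qed.

(** A precompact set is almost contained in the span of finitely many [z w], whose
    other coordinates vanish. *)
Lemma trace_mean_compact (K : 'L(csub Z, csub Z)) : compact_operator K ->
  forall eps : R, 0 < eps -> exists n0, forall n, (n0 <= n)%N ->
    `|trace_mean n K| <= eps.
Proof.
move=> cK eps e0; have C12 : 0 < 12 * C + 1 by rewrite ltr_wpDl// mulr_ge0.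
have d0 : 0 < eps / (12 * C + 1) by rewrite divr_gt0.
have [s Hs] := compact_operator_net cK d0.
have [n0 Hn0] : exists n0, forall y, y \in s -> forall w, (n0 <= size w)%N ->
    `|zcoord w y| <= C * (eps / (12 * C + 1)).
  elim: s {Hs} => [|y s [n0 IH]]; first by exists 0.
  have [t [y' [y't yy']]] := Z_dense y d0.
  exists (maxn n0 (\sum_(p <- t) (size p.2).+1)) => y1.
  rewrite inE => /predU1P[->|y1s] w; rewrite geq_max => /andP[nw tw];
    last exact: IH.
  have -> : zcoord w y = zcoord w (y - y').
    rewrite opB (op_comb _ y't) big_seq big1 ?subr0// => p pt.
    rewrite zcoord_zz (_ : (w == p.2) = false) ?scaler0//.
    apply/negbTE; apply: contraTneq tw => ->; rewrite -ltnNge.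
    by rewrite (big_rem p)//= ltnS leq_addr.
  by apply: le_trans (zcoord_le _ _) _; rewrite ler_wpM2l.
exists n0 => n nn0; apply: trace_mean_le => w wn.
have x1 : `|6^-1 *: zz w| <= 1.
  by rewrite normrZ ger0_norm ?invr_ge0// ler_pdivrMl// mulr1 norm_zz.
have [y ys Ky] := Hs _ x1.
have -> : zcoord w (K (zz w)) = 6 * zcoord w (K (6^-1 *: zz w)).
  by rewrite !opZ -[RHS]/(6 * (6^-1 * zcoord w (K (zz w)))) mulrA mulfV
    ?mul1r// pnatr_eq0.
rewrite normrM ger0_norm//.
have := ler_normD (zcoord w (K (6^-1 *: zz w) - y)) (zcoord w y).
rewrite -linearD subrK.
have := Hn0 y ys w; rewrite wn => /(_ nn0).
have := le_trans (zcoord_le w _) (ler_wpM2l C0 Ky).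
have : eps / (12 * C + 1) * (12 * C + 1) = eps by rewrite divfK// gt_eqF.
by have := ltW d0; lra.
Qed.

Lemma trace_mean_tail k m (T : 'L(csub Z, csub Z)) :
  `|trace_mean (k + m + 7).+1 T - trace_mean (k + 7).+1 T| <=
    10 * C * `|T| * (32 * ((31 / 32) ^+ k - (31 / 32) ^+ (k + m))).
Proof.
elim: m => [|m IH]; first by rewrite addn0 !subrr normr0 !mulr0.
rewrite [(k + m.+1)%N]addnS addSn exprS.
rewrite -(subrKA (trace_mean (k + m + 7).+1 T)).
apply: le_trans (ler_normD _ _) _.
have := trace_mean_diff (k + m + 7) T; rewrite addnK.
move: IH; set x := (31 / 32) ^+ (k + m); set y := (31 / 32) ^+ k.
by set D := 10 * C * `|T|; lra.
Qed.

(** The identity has trace means one and a compact operator has vanishing trace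
    means, while the convergence of the trace means is uniform on bounded sets of
    operators. *)
Lemma no_compact_approximation (K : nat -> 'L(csub Z, csub Z)) (M : R) :
  (forall n, compact_operator (K n)) -> (forall n x, `|K n x| <= M * `|x|) ->
  ~ forall x, K^~ x @ \oo --> x.
Proof.
move=> cK KM Kcvg.
have KT n : `|K n - idop (csub Z)| <= `|M| + 1.
  apply: opnorm_le_of => [|x]; first exact: addr_ge0.
  rewrite -[leLHS]/(`|K n x - x|); apply: le_trans (ler_normB _ _) _.
  rewrite mulrDl mul1r lerD2r; apply: le_trans (KM n x) _.
  by rewrite ler_wpM2r// ler_norm.
pose D := 10 * C * (`|M| + 1) * 32.
have D0 : 0 <= D by rewrite !mulr_ge0// addr_ge0.
have [k Hk] : exists k, D * (31 / 32) ^+ k <= 1 / 4.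
  have : (fun k => D * (31 / 32) ^+ k) @ \oo --> D * (0 : R).
    by apply: cvgMl_tmp; apply: cvg_expr; rewrite ger0_norm; lra.
  rewrite mulr0 => /seq_cvgP/(_ (1 / 4))[|k /(_ k (leqnn k))]; first by lra.
  by rewrite subr0 => H; exists k; apply: le_trans H; exact: ler_norm.
pose n := (k + 7).+1.
have C4 : 0 < 4 * (C + 1) by rewrite mulr_gt0// ltr_wpDl.
have [j Hj] : exists j, forall w : n.-tuple bool,
    `|K j (zz w) - zz w| <= (4 * (C + 1))^-1.
  suff [j Hj] : exists j, forall i, (j <= i)%N ->
      forall w, w \in enum {: n.-tuple bool} ->
        `|K i (zz w) - zz w| <= (4 * (C + 1))^-1.
    by exists j => w; apply: (Hj j (leqnn j)); rewrite mem_enum.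
  elim: (enum _) => [|w s [j Hj]]; first by exists 0.
  have /seq_cvgP/(_ (4 * (C + 1))^-1)[|j' Hj'] := Kcvg (zz w);
    first by rewrite invr_gt0.
  exists (maxn j j') => i; rewrite geq_max => /andP[ji j'i] w'.
  by rewrite inE => /predU1P[->|]; [exact: Hj'|exact: Hj].
pose T := K j - idop (csub Z).
have Tn : `|trace_mean n T| <= 1 / 4.
  apply: trace_mean_le => w /eqP wn; apply: le_trans (zcoord_le _ _) _.
  apply: le_trans (ler_wpM2l C0 (Hj (Tuple wn))) _.
  by rewrite ler_pdivrMr//; lra.
have q0 : 0 < 1 / 4 :> R by lra.
have [n0 Hn0] := trace_mean_compact (cK j) q0.
have := trace_mean_tail k n0 T; have := Hn0 (k + n0 + 7).+1.
have -> : (n0 <= (k + n0 + 7).+1)%N by lia.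
move=> /(_ isT) H1 H2.
have H3 : `|trace_mean (k + n0 + 7).+1 T - trace_mean n T| <= 1 / 4.
  apply: le_trans H2 _; apply: le_trans Hk.
  have x0 : 0 <= (31 / 32 : R) ^+ (k + n0) by rewrite exprn_ge0//; lra.
  have y0 : 0 <= (31 / 32 : R) ^+ k by rewrite exprn_ge0//; lra.
  have TC : 10 * C * `|T| <= 10 * C * (`|M| + 1).
    by rewrite ler_wpM2l ?mulr_ge0//; exact: KT.
  have TC0 : 0 <= 10 * C * `|T| by rewrite !mulr_ge0.
  rewrite /D; move: TC TC0; set a := 10 * C * _; set a' := 10 * C * _ => aa' a0.
  by have := mulr_ge0 a0 x0; have := ler_wpM2r y0 aa'; lra.
have : 1 = trace_mean (k + n0 + 7).+1 (K j) - trace_mean (k + n0 + 7).+1 T.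
  by rewrite /T trace_meanB trace_mean_id opprB addrC subrK.
move: H1 H3 Tn; rewrite !ler_norml; lra.
Qed.

Lemma infinite_dim_Z : infinite_dim (csub Z).
Proof.
move=> [n [b Hb]].
have /choice[c Hc] (w : seq bool) : exists c : 'I_n ->
  R, zz w = \sum_i c i *: b i.
  exact: Hb.
pose w (i : nat) := nseq i false.
pose A : 'M[R]_(n.+1, n) := \matrix_(i, k) zcoord (w i) (b k).
pose B : 'M[R]_(n, n.+1) := \matrix_(k, j) c (w j) k.
have AB : A *m B = 1%:M.
  apply/matrixP => i j; rewrite !mxE.
  have : zcoord (w i) (zz (w j)) = (i == j)%:R.
    have wE : (w i == w j) = (i == j).
      by apply/eqP/eqP => [/(congr1 size)|-> //]; rewrite !size_nseq => /val_inj.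
    by rewrite zcoord_zz wE.
  rewrite Hc linear_sum => <-; apply: eq_bigr => k _.
  by rewrite /A /B !mxE -[RHS]/(zcoord (w i) (c (w j) k *: b k)) opZ mulrC.
have := mxrankM_maxl A B; rewrite AB mxrank1 => /leq_trans/(_ (rank_leq_col A)).
by rewrite ltnn.
Qed.

End three_generations.

(** The functionals of the construction are first bounded on finite combinations of
    the vectors [e k], and then extended by continuity to the closed span [Z] of the
    vectors [z e w]. *)
Lemma subspace_without_compact_approximation {R : realType}
    {X : completeNormedModType R} (Y : closed_subspace X) (C : R) : 0 <= C ->
  (forall N : nat -> nat, exists u : nat -> nat -> X,
    (forall L i, csub_set Y (u L i) /\ `|u L i| <= 1) /\
    forall M (c : nat -> nat -> R) n, (n < M)%N ->
      \sum_(0 <= i < N n) `|c n i| <=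
      C * `|\sum_(0 <= L < M) \sum_(0 <= i < N L) c L i *: u L i|) ->
  exists Z : closed_subspace X, [/\ Z `<=` Y, infinite_dim (csub Z) &
    forall (K : nat -> 'L(csub Z, csub Z)) (M : R),
      (forall n, compact_operator (K n)) -> (forall n x, `|K n x| <= M * `|x|) ->
      ~ forall x, K^~ x @ \oo --> x].
Proof.
move=> C0 block.
have [u [u_ball u_l1]] :=
  block (fun L => #|{: L.-tuple bool * {ffun L.-tuple bool -> bool}}|).
have [e [eY e_block e_coef]] := string_system size_label C0 u_ball u_l1.
have [Z [Zz Z_dense ZY]] := closed_span (z e).
pose zz w : csub Z := Csub (mem_set (Zz w) : z e w \in in_csub Z).
have Z_dense_e (v : csub Z) (eps : R) : 0 < eps -> exists s (v' : csub Z),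
    csub_val v' = comb e s /\ `|v - v'| <= eps.
  move=> e0; have [s [v' [v's vv']]] := Z_dense v eps e0.
  exists (flatten [seq scale_comb p.1 (zcomb p.2) | p <- s]), v'; split=> //.
  rewrite v's; elim: s {v's vv'} => [|p s IH]; first by rewrite /comb !big_nil.
  rewrite [RHS](_ : _ = comb e (scale_comb p.1 (zcomb p.2) ++
    flatten [seq scale_comb p.1 (zcomb p.2) | p <- s]))//.
  by rewrite combD combZ -IH /comb big_cons.
have /choice[F FE] (k : seq bool) : exists F : 'L(csub Z, R^o),
    forall s (v : csub Z), csub_val v = comb e s -> F v = coef s k.
  apply: (extend_coordinate C0 Z_dense_e) => s.
  have H : {in [set: unit]%SET &, forall i j, label k = label k -> i = j}.
    by move=> [] [].
  have := coef_sum e_coef s (fun _ : unit => erefl (size k)) H.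
  by rewrite big_const cardsT card_unit /= addr0.
have F_sum (J : finType) (A : {set J}) (f : J -> seq bool) n :
    (forall j, size (f j) = n) ->
    {in A &, forall i j, label (f i) = label (f j) -> i = j} ->
    forall v, \sum_(j in A) `|F (f j) v| <= C * `|v|.
  move=> fn flab; apply: (coordinate_block C0 Z_dense_e FE) => s.
  exact: (coef_sum e_coef s fn flab).
have zzE w : csub_val (zz w) = z e w by [].
exists Z; split.
- apply: ZY => w; rewrite /z /comb /zcomb; have [Y0 YL] := csub_submod Y.
  elim: (_ :: _) => [|p s IH]; first by rewrite big_nil; exact/set_mem.
  by rewrite big_cons; apply/set_mem/YL; exact/mem_set.
- exact: (infinite_dim_Z zzE FE).
exact: (no_compact_approximation C0 e_block zzE Z_dense FE F_sum).
Qed.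

(** * Saturation and failure of the Lotz property *)

Theorem corollary5p7 (R : realType) (X : completeNormedModType R)
  (X_infinite_dim : infinite_dim X)
  (X_separable : separable X)
  (X_reflexive : reflexive_space X)
  (X_basis : exists e : nat -> X, schauder_basis e)
  (X_HI : hereditarily_indecomposable X)
  (X_spreading : forall Y : closed_subspace X, infinite_dim (csub Y) ->
    exists x : nat -> csub Y,
      [/\ forall n, `|x n| = 1,
          weakly_null x &
          generates_spreading_model x (@l1_unit R)])
  (X_scalar_plus_SS : forall Y : closed_subspace X, infinite_dim (csub Y) ->
    forall T : 'L(csub Y, csub Y),
      exists (alpha : R) (S : 'L(csub Y, csub Y)),
        strictly_singular S /\ T = alpha *: idop (csub Y) + S)
  (X_SS3_compact : forall Y : closed_subspace X, infinite_dim (csub Y) ->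
    forall Q S T : 'L(csub Y, csub Y),
      strictly_singular Q -> strictly_singular S -> strictly_singular T ->
      compact_operator (Q \oL S \oL T)) :
  lotz_saturated X /\ ~ lotz X.

Proof.
have [e /schauder_coordinates[a [K [K0 a_cvg ae K_bound]]]] := X_basis.
split; last exact: (basis_not_lotz K0 a_cvg ae K_bound).
move=> Y Yinf; have [x [x1 x_null x_l1]] := X_spreading Y Yinf.
have K8 : 0 <= 8 * K by rewrite mulr_ge0.
have [Z [ZY Zinf no_approx]] := subspace_without_compact_approximation K8
  (block_l1_system a_cvg K_bound x1 x_null x_l1).
exists Z; split=> //; apply: lotz_of_no_compact_approximation no_approx => V.
have [alpha [S [SS ->]]] := X_scalar_plus_SS Z Zinf V.
by exists alpha, S; split=> //; exact: X_SS3_compact.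
Qed.
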